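(* Let $d$ be a metric on $\partial\mathbf{H}^n_{\mathbb K}=\mathfrak H_{\mathbb K}\cup\{\infty\}$ which induces the same topology on $\partial\mathbf{H}^n_{\mathbb K}$ as the Korányi metric $d_{\mathfrak H}$ and has the same remote point $\infty$ as $d_{\mathfrak H}$. Assume further that $\mathcal M_d=\mathcal M_{d_{\mathfrak H}}$. Then there exist $\alpha\in(0,1]$ and $\beta>0$ such that $d=\beta\cdot d_{\mathfrak H}^{\alpha}$.
   Context: $\mathbb K$ is one of $\mathbb R,\mathbb C,\mathbb H,\mathbb O$ (reals, complex numbers, quaternions, octonions), with conjugation $z\mapsto\overline z$ (the identity if $\mathbb K=\mathbb R$) and norm $|z|$; $n\ge 2$ is an integer, and $n=2$ if $\mathbb K=\mathbb O$. Put $\Im(\mathbb K)=\{z\in\mathbb K: z=-\overline z\}$, $\operatorname{Im}z=(z-\overline z)/2$, and $\|\zeta\|^2=\sum_i|\zeta_i|^2$ for $\zeta\in\mathbb K^{n-1}$. The $\mathbb K$-Heisenberg group $\mathfrak H_{\mathbb K}$ is the set $\mathbb K^{n-1}\times\Im(\mathbb K)$ with the multiplication $(\zeta,v)*(\zeta',v')=(\zeta+\zeta',\,v+v'+2\omega(\zeta,\zeta'))$, where $\omega(\zeta,\zeta')=\operatorname{Im}\big(\sum_i\overline{\zeta'_i}\zeta_i\big)$; thus $(\zeta,v)^{-1}=(-\zeta,-v)$, and the origin is $o=(0,0)$. The boundary of $\mathbb K$-hyperbolic space $\mathbf H^n_{\mathbb K}$ is identified with $\partial\mathbf{H}^n_{\mathbb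 K}=\mathfrak H_{\mathbb K}\cup\{\infty\}$. The Korányi gauge is $|(\zeta,v)|_{\mathbb K}=(\|\zeta\|^4+|v|^2)^{1/4}$ and the Korányi metric is $d_{\mathfrak H}(p,q)=|q^{-1}*p|_{\mathbb K}$ on $\mathfrak H_{\mathbb K}$. A metric on $\partial\mathbf{H}^n_{\mathbb K}$ with remote point $\infty$ means a metric $d$ on $S=\mathfrak H_{\mathbb K}$ extended to $\overline S=S\cup\{\infty\}$ by $d(p,\infty)=+\infty$ for $p\in S$ and $d(\infty,\infty)=0$. The $d$-topology on $\overline S$ is the one extending the metric topology of $S$ for which the sets $\{q\in S:d(o,q)>R\}\cup\{\infty\}$, $R>0$, are basic neighbourhoods of $\infty$. For pairwise distinct $p_1,\dots,p_4\in\overline S$ the metric cross-ratio is $|\mathbb X^d|(p_1,p_2,p_3,p_4)=\frac{d(p_4,p_2)}{d(p_4,p_1)}\cdot\frac{d(p_3,p_1)}{d(p_3,p_2)}$, where, if one of the points is $\infty$, the two factors containing $\infty$ are cancelled. The Möbius group $\mathcal M_d$ is the group of homeomorphisms of $\overline S$ (in the $d$-topology) which leave $|\mathbb X^d|$ invariant on all quadruples of pairwise distinct points of $\overline S$. *)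

(* Defs.v *)
From HB Require Import structures.
From mathcomp Require Import all_boot all_order all_algebra.
From mathcomp Require Import all_classical all_reals all_analysis.

Set Implicit Arguments.
Unset Strict Implicit.
Unset Printing Implicit Defensive.

Import Order.TTheory GRing.Theory Num.Theory.
Local Open Scope classical_set_scope.
Local Open Scope ring_scope.

(* Cayley-Dickson doubling of the reals: k = 0, 1, 2, 3 gives R, C, H, O. *)
Fixpoint cayley_dickson (R : realType) (k : nat) : lmodType R :=
  if k is k'.+1 then (cayley_dickson R k' * cayley_dickson R k')%type
  else R^o.

Fixpoint cd_conj (R : realType) (k : nat) :
    cayley_dickson R k -> cayley_dickson R k :=
  match k with
  | 0 => fun x => x
  | k'.+1 => fun x => (cd_conj x.1, - x.2)
  end.

(* (a, b)(c, d) = (ac - d^* b, da + bc^* ) *)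
Fixpoint cd_mul (R : realType) (k : nat) :
    cayley_dickson R k -> cayley_dickson R k -> cayley_dickson R k :=
  match k with
  | 0 => fun x y : R => x * y
  | k'.+1 => fun x y =>
      (cd_mul x.1 y.1 - cd_mul (cd_conj y.2) x.2,
       cd_mul y.2 x.1 + cd_mul x.2 (cd_conj y.1))
  end.

Fixpoint cd_normsq (R : realType) (k : nat) : cayley_dickson R k -> R :=
  match k with
  | 0 => fun x : R => x ^+ 2
  | k'.+1 => fun x => cd_normsq x.1 + cd_normsq x.2
  end.

Definition cd_norm (R : realType) (k : nat) (x : cayley_dickson R k) : R :=
  Num.sqrt (cd_normsq x).

Variant division_algebra := Reals | Complexes | Quaternions | Octonions.

Definition doublings (K : division_algebra) : nat :=
  match K with
  | Reals => 0 | Complexes => 1 | Quaternions => 2 | Octonions => 3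
  end.

Definition carrier (R : realType) (K : division_algebra) : lmodType R :=
  cayley_dickson R (doublings K).

Definition imaginary (R : realType) (k : nat) : pred (cayley_dickson R k) :=
  fun z => z == - cd_conj z.

Lemma cd_conjB (R : realType) (k : nat) (x y : cayley_dickson R k) :
  cd_conj (x - y) = cd_conj x - cd_conj y.
Proof. by elim: k x y => //= k IH x y; rewrite IH opprD. Qed.

Lemma cd_conjZ (R : realType) (k : nat) (a : R) (x : cayley_dickson R k) :
  cd_conj (a *: x) = a *: cd_conj x.
Proof. by elim: k x => //= k IH x; rewrite IH -scalerN. Qed.

Lemma cd_conjK (R : realType) (k : nat) : involutive (@cd_conj R k).
Proof. by elim: k => //= k IH [x y] /=; rewrite IH opprK. Qed.

Lemma imaginary_zmod_closed (R : realType) (k : nat) :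
  zmod_closed (@imaginary R k).
Proof.
split=> [|x y /eqP xi /eqP yi]; rewrite unfold_in /imaginary.
  by have := cd_conjB (0 : cayley_dickson R k) 0; rewrite !subrr => ->; rewrite oppr0.
by rewrite cd_conjB opprB {1}xi {1}yi opprK addrC.
Qed.

HB.instance Definition _ (R : realType) (k : nat) :=
  GRing.isZmodClosed.Build (cayley_dickson R k) (@imaginary R k)
    (imaginary_zmod_closed R k).

Record imag (R : realType) (K : division_algebra) := Imag {
  imag_val :> carrier R K;
  imag_valP : imaginary imag_val }.

HB.instance Definition _ (R : realType) (K : division_algebra) :=
  [isSub for @imag_val R K].
HB.instance Definition _ (R : realType) (K : division_algebra) :=
  [Choice of imag R K by <:].
HB.instance Definition _ (R : realType) (K : division_algebra) :=
  [SubChoice_isSubZmodule of imag R K by <:].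

Lemma im_part_subproof (R : realType) (K : division_algebra)
  (z : carrier R K) : imaginary (2^-1 *: (z - cd_conj z)).
Proof. by rewrite /imaginary cd_conjZ -scalerN cd_conjB cd_conjK opprB. Qed.

Definition im_part (R : realType) (K : division_algebra) (z : carrier R K) :
  imag R K := Imag (im_part_subproof z).

Definition heis (R : realType) (K : division_algebra) (n : nat) : Type :=
  ('rV[carrier R K]_(n.-1) * imag R K)%type.

HB.instance Definition _ (R : realType) (K : division_algebra) (n : nat) :=
  Choice.on (heis R K n).

Definition omega (R : realType) (K : division_algebra) (n : nat)
    (z w : 'rV[carrier R K]_(n.-1)) : imag R K :=
  im_part (\sum_(i < n.-1) cd_mul (cd_conj (w 0 i)) (z 0 i)).

Definition heis_origin (R : realType) (K : division_algebra) (n : nat) :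
  heis R K n := (0, 0).

Definition heis_mul (R : realType) (K : division_algebra) (n : nat)
    (p q : heis R K n) : heis R K n :=
  (p.1 + q.1, p.2 + q.2 + omega p.1 q.1 *+ 2).

Definition heis_inv (R : realType) (K : division_algebra) (n : nat)
    (p : heis R K n) : heis R K n :=
  (- p.1, - p.2).

Definition vec_normsq (R : realType) (K : division_algebra) (n : nat)
    (z : 'rV[carrier R K]_(n.-1)) : R :=
  \sum_(i < n.-1) cd_norm (z 0 i) ^+ 2.

Definition koranyi_gauge (R : realType) (K : division_algebra) (n : nat)
    (p : heis R K n) : R :=
  (vec_normsq p.1 ^+ 2 + cd_norm (imag_val p.2) ^+ 2) `^ 4^-1.

Definition koranyi (R : realType) (K : division_algebra) (n : nat)
    (p q : heis R K n) : R :=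
  koranyi_gauge (heis_mul (heis_inv q) p).

Definition is_metric (R : realType) (S : Type) (d : S -> S -> R) : Prop :=
  [/\ forall p q, 0 <= d p q,
      forall p q, d p q = 0 <-> p = q,
      forall p q, d p q = d q p &
      forall p q r, d p r <= d p q + d q r].

(* The boundary is [option (heis R K n)], with [None] the point at infinity. *)
Definition ext_dist (R : realType) (S : Type) (d : S -> S -> R)
    (p q : option S) : \bar R :=
  match p, q with
  | Some p', Some q' => (d p' q')%:E
  | None, None => 0%E
  | _, _ => +oo%E
  end.

(* An alias of [option (heis R K n)] indexed by [d], so that every [d] gives
   rise to its own topology. *)
Definition boundary (R : realType) (K : division_algebra) (n : nat)
    (d : heis R K n -> heis R K n -> R) : Type := option (heis R K n).

HB.instance Definition _ (R : realType) (K : division_algebra) (n : nat)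
    (d : heis R K n -> heis R K n -> R) :=
  Choice.on (boundary d).

(* Spelled out on [d : S -> S -> R] without assuming that [d] is a metric: the
   axioms of a topology hold anyway. *)
Definition boundary_open (R : realType) (K : division_algebra) (n : nat)
    (d : heis R K n -> heis R K n -> R) : set (set (boundary d)) :=
  [set U |
    (forall p, U (Some p) ->
       exists2 r : R, 0 < r & forall q, d p q < r -> U (Some q)) /\
    (U None ->
       exists2 r : R, 0 < r &
         forall q, r < d (heis_origin R K n) q -> U (Some q))].

Section boundary_topology.
Context (R : realType) (K : division_algebra) (n : nat).
Variable d : heis R K n -> heis R K n -> R.

Lemma boundary_openT : @boundary_open R K n d setT.
Proof. by split=> [p|] _; exists 1. Qed.

Lemma boundary_openI : setI_closed (@boundary_open R K n d).
Proof.
move=> A B [A1 A2] [B1 B2]; split=> [p [/A1[r r0 Ar] /B1[s s0 Bs]]|].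
  exists (Num.min r s); first by rewrite lt_min r0.
  by move=> q; rewrite lt_min => /andP[/Ar ? /Bs ?].
move=> [/A2[r r0 Ar] /B2[s s0 Bs]]; exists (Num.max r s).
  by rewrite lt_max r0.
by move=> q; rewrite gt_max => /andP[/Ar ? /Bs ?].
Qed.

Lemma boundary_open_bigU (I : Type) (f : I -> set (boundary d)) :
  (forall i, boundary_open (f i)) -> boundary_open (\bigcup_i f i).
Proof.
move=> fo; split=> [p [i _ /(fo i).1[r r0 fr]]|[i _ /(fo i).2[r r0 fr]]].
  by exists r => // q /fr; exists i.
by exists r => // q /fr; exists i.
Qed.

HB.instance Definition _ := isOpenTopological.Build (boundary d)
  boundary_openT boundary_openI boundary_open_bigU.

End boundary_topology.

Definition same_topology (R : realType) (K : division_algebra) (n : nat)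
    (d d' : heis R K n -> heis R K n -> R) : Prop :=
  forall U : set (option (heis R K n)),
    open (U : set (boundary d)) <-> open (U : set (boundary d')).

(* Exactly two of the four factors of a cross-ratio of pairwise distinct
   points contain infinity if one of the points is infinity, one in the
   numerator and one in the denominator; replacing them by 1 cancels them. *)
Definition cr_factor (R : realType) (S : Type) (d : S -> S -> R)
    (p q : option S) : R :=
  if (p, q) is (Some p', Some q') then d p' q' else 1.

Definition cross_ratio (R : realType) (S : Type) (d : S -> S -> R)
    (p1 p2 p3 p4 : option S) : R :=
  cr_factor d p4 p2 / cr_factor d p4 p1 *
  (cr_factor d p3 p1 / cr_factor d p3 p2).

Definition is_homeomorphism (T U : topologicalType) (f : T -> U) : Prop :=
  continuous f /\
  exists g : U -> T, [/\ cancel f g, cancel g f & continuous g].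

Definition moebius (R : realType) (K : division_algebra) (n : nat)
    (d : heis R K n -> heis R K n -> R) :
    set (option (heis R K n) -> option (heis R K n)) :=
  [set f | is_homeomorphism (f : boundary d -> boundary d) /\
    forall p1 p2 p3 p4 : option (heis R K n),
      uniq [:: p1; p2; p3; p4] ->
      cross_ratio d (f p1) (f p2) (f p3) (f p4) = cross_ratio d p1 p2 p3 p4].

(* Main.v *)
Require Import Defs.
From mathcomp Require Import all_boot all_order all_algebra.
From mathcomp Require Import all_classical all_reals all_analysis.
From mathcomp Require Import ring lra.

Import Order.TTheory GRing.Theory Num.Theory.
Local Open Scope classical_set_scope.
Local Open Scope ring_scope.

(** Left translations, the dilations [(z, v) |-> (r z, r^2 v)] and the Koranyi
    inversion are Moebius transformations for the Koranyi metric
    ([moebius_translation], [moebius_dil], [moebius_einv]), hence also for [d].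
    The argument uses no other element of the Moebius group.

    A Moebius transformation of [d] that fixes infinity is a similarity of [d]
    ([d_similarity]). Since the dilation of factor 2 maps a horizontal point to
    its square and a vertical one to its fourth power, the ratio of a left
    translation is 1 ([d_mull]); so [d] is determined by the function [dnorm],
    the distance to the origin. The ratio of the dilation of factor [r] is
    multiplicative in [r], and it is below 1 for small [r] because the two
    topologies agree, so it is [r ^ alpha] with [alpha > 0] ([dnorm_dil_powR]).
    Squaring a horizontal point and the triangle inequality give [alpha <= 1]
    ([exponent_le1]).

    It remains to see that [dnorm p] is a constant multiple of the power [alpha]
    of the gauge [g p]. Write [p = (z, v)] and [a = |z|^2 + v], an element of the
    algebra with [|a| = (g p)^2]. The inversion is
    [(z, v) |-> (- z a / |a|^2, - v / |a|^2)], and invariance of the cross-ratios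
    containing the origin and infinity makes the product of the values of [dnorm]
    at a point and at its inversion a constant [C] ([dnorm_hinv]). The group
    inverse of the inverted point is a dilation of [(z u, v)], with [u = a / |a|];
    therefore
    [dnorm (z, v) * dnorm (z u, v) = C * (g p)^(2 alpha)] ([dnorm_twist]). The
    points [(z u^m, v)] have the same gauge and the same [u], and consecutive ones
    satisfy this equation. If [u] has finite odd order the sequence closes up after
    an odd number of steps, which forces all its values to be equal, to
    [sqrt C * (g p)^alpha] ([dnorm_hpoint]). The angles of finite odd order are
    dense ([rational_angle]) and both sides are continuous
    ([dnorm_gauge_closed]), so the formula holds at every point.

    The facts on the algebra behind this are bilinearity of the product, the
    adjunction [cd_dot_mulr], and for at most three doublings the identity
    [(x a) (conj a) = |a|^2 x] ([cd_mul_conjr]), from which multiplicativity of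
    the norm follows. Associativity is used only for the norm of the hermitian
    form ([normsq_herm_vmulr]), where octonions are allowed one coordinate. *)

(** * Cayley-Dickson algebras *)

Section CayleyDickson.
Context {R : realType}.
Local Notation A := (cayley_dickson R).

(** The multiplicative unit. *)
Fixpoint cd_one (k : nat) : A k :=
  if k is k'.+1 then (cd_one k', 0) else 1 : R.

(** The euclidean inner product whose quadratic form is [cd_normsq]. *)
Fixpoint cd_dot {k : nat} : A k -> A k -> R :=
  match k with
  | 0 => fun x y : R => x * y
  | k'.+1 => fun x y => cd_dot x.1 y.1 + cd_dot x.2 y.2
  end.

Lemma cd_conjD {k} (x y : A k) : cd_conj (x + y) = cd_conj x + cd_conj y.
Proof. by elim: k x y => //= k IH x y; rewrite IH opprD. Qed.

Lemma cd_conjN {k} (x : A k) : cd_conj (- x) = - cd_conj x.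
Proof. by rewrite -scaleN1r cd_conjZ scaleN1r. Qed.

(** The product is defined by a mutual use of both factors, so additivity in the
    two arguments has to be proved simultaneously; likewise for scaling. *)
Lemma cd_mul_additive {k} :
  (forall x y z : A k, cd_mul (x + y) z = cd_mul x z + cd_mul y z) /\
  (forall x y z : A k, cd_mul z (x + y) = cd_mul z x + cd_mul z y).
Proof.
elim: k => [|k [IHl IHr]] /=.
  by split=> x y z; [exact: mulrDl|exact: mulrDr].
by split=> x y z; congr pair; rewrite /= ?cd_conjD ?IHl ?IHr /= ?opprD addrACA.
Qed.

Lemma cd_mulDl {k} (x y z : A k) : cd_mul (x + y) z = cd_mul x z + cd_mul y z.
Proof. exact: cd_mul_additive.1. Qed.

Lemma cd_mulDr {k} (z x y : A k) : cd_mul z (x + y) = cd_mul z x + cd_mul z y.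
Proof. exact: cd_mul_additive.2. Qed.

Lemma cd_mul_scalable {k} (a : R) :
  (forall x y : A k, cd_mul (a *: x) y = a *: cd_mul x y) /\
  (forall x y : A k, cd_mul x (a *: y) = a *: cd_mul x y).
Proof.
elim: k => [|k [IHl IHr]] /=.
  by split=> x y; [exact: (esym (@mulrA R a x y))|exact: (@mulrCA R x a y)].
by split=> x y; congr pair;
  rewrite /= ?cd_conjZ ?IHl ?IHr -?scalerBr -?scalerDr.
Qed.

Lemma cd_mulZl {k} (a : R) (x y : A k) : cd_mul (a *: x) y = a *: cd_mul x y.
Proof. exact: (cd_mul_scalable a).1. Qed.

Lemma cd_mulZr {k} (a : R) (x y : A k) : cd_mul x (a *: y) = a *: cd_mul x y.
Proof. exact: (cd_mul_scalable a).2. Qed.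

Lemma cd_mulNl {k} (x y : A k) : cd_mul (- x) y = - cd_mul x y.
Proof. by rewrite -scaleN1r cd_mulZl scaleN1r. Qed.

Lemma cd_mulNr {k} (x y : A k) : cd_mul x (- y) = - cd_mul x y.
Proof. by rewrite -scaleN1r cd_mulZr scaleN1r. Qed.

Lemma cd_mul0l {k} (x : A k) : cd_mul 0 x = 0.
Proof. by have := cd_mulZl 0 0 x; rewrite !scale0r. Qed.

Lemma cd_mul0r {k} (x : A k) : cd_mul x 0 = 0.
Proof. by have := cd_mulZr 0 x 0; rewrite !scale0r. Qed.

Lemma cd_conj0 {k} : cd_conj (0 : A k) = 0.
Proof. by have := cd_conjZ 0 (0 : A k); rewrite !scale0r. Qed.

Lemma cd_conj_one k : cd_conj (cd_one k) = cd_one k.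
Proof. by elim: k => //= k ->; rewrite oppr0. Qed.

Lemma cd_mul_one {k} (x : A k) : cd_mul x (cd_one k) = x.
Proof.
elim: k x => [|k IH] /= x; first exact: mulr1.
by rewrite cd_conj_one !IH cd_conj0 !cd_mul0l subr0 add0r; case: x.
Qed.

Lemma cd_conj_mul {k} (x y : A k) :
  cd_conj (cd_mul x y) = cd_mul (cd_conj y) (cd_conj x).
Proof.
elim: k x y => [|k IH] /= x y; first exact: mulrC.
congr pair; last by rewrite !cd_mulNl cd_conjK opprD addrC.
by rewrite cd_conjB !IH cd_conjN cd_mulNl cd_mulNr opprK cd_conjK.
Qed.

Lemma cd_dotC {k} (x y : A k) : cd_dot x y = cd_dot y x.
Proof. by elim: k x y => [|k IH] /= x y; [exact: mulrC|congr (_ + _)]. Qed.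

Lemma cd_dotDl {k} (x y z : A k) : cd_dot (x + y) z = cd_dot x z + cd_dot y z.
Proof.
by elim: k x y z => [|k IH] /= x y z; [exact: mulrDl|rewrite !IH addrACA].
Qed.

Lemma cd_dotZl {k} (a : R) (x y : A k) : cd_dot (a *: x) y = a * cd_dot x y.
Proof.
by elim: k x y => [|k IH] /= x y; [rewrite -mulrA|rewrite !IH mulrDr].
Qed.

Lemma cd_dotDr {k} (x y z : A k) : cd_dot x (y + z) = cd_dot x y + cd_dot x z.
Proof. by rewrite cd_dotC cd_dotDl !(cd_dotC x). Qed.

Lemma cd_dotZr {k} (a : R) (x y : A k) : cd_dot x (a *: y) = a * cd_dot x y.
Proof. by rewrite cd_dotC cd_dotZl cd_dotC. Qed.

Lemma cd_dotNl {k} (x y : A k) : cd_dot (- x) y = - cd_dot x y.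
Proof. by rewrite -scaleN1r cd_dotZl mulN1r. Qed.

Lemma cd_dotNr {k} (x y : A k) : cd_dot x (- y) = - cd_dot x y.
Proof. by rewrite cd_dotC cd_dotNl cd_dotC. Qed.

Lemma cd_dot0l {k} (x : A k) : cd_dot 0 x = 0.
Proof. by have := cd_dotZl 0 0 x; rewrite scale0r mul0r. Qed.

Lemma cd_dot0r {k} (x : A k) : cd_dot x 0 = 0.
Proof. by rewrite cd_dotC cd_dot0l. Qed.

Lemma cd_dotE {k} (x : A k) : cd_normsq x = cd_dot x x.
Proof. by elim: k x => [|k IH] /= x; rewrite ?expr2 ?IH. Qed.

Lemma cd_normsq_ge0 {k} (x : A k) : 0 <= cd_normsq x.
Proof. by elim: k x => [|k IH] /= x; rewrite ?sqr_ge0 ?addr_ge0. Qed.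

Lemma cd_normsq_eq0 {k} (x : A k) : cd_normsq x = 0 -> x = 0.
Proof.
elim: k x => [|k IH] /= x; first by move/eqP; rewrite sqrf_eq0 => /eqP.
case: x => x y /= /eqP; rewrite paddr_eq0 ?cd_normsq_ge0//.
by move=> /andP[/eqP /IH -> /eqP /IH ->].
Qed.

Lemma cd_normsqZ {k} (a : R) (x : A k) :
  cd_normsq (a *: x) = a ^+ 2 * cd_normsq x.
Proof. by rewrite !cd_dotE cd_dotZl cd_dotZr mulrA. Qed.

Lemma cd_normsqN {k} (x : A k) : cd_normsq (- x) = cd_normsq x.
Proof. by rewrite -scaleN1r cd_normsqZ sqrrN expr1n mul1r. Qed.

Lemma cd_normsqD {k} (x y : A k) :
  cd_normsq (x + y) = cd_normsq x + 2 * cd_dot x y + cd_normsq y.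
Proof. by rewrite !cd_dotE cd_dotDl !cd_dotDr (cd_dotC y x); ring. Qed.

Lemma cd_normsq_one k : cd_normsq (cd_one k) = 1.
Proof.
elim: k => [|k IH] /=; first exact: expr1n.
by rewrite IH cd_dotE cd_dot0l addr0.
Qed.

(** Identities between vectors are proved by pairing both sides with an
    arbitrary vector, which turns them into ring identities over the reals. *)
Lemma cd_dot_ext {k} (x y : A k) :
  (forall w, cd_dot w x = cd_dot w y) -> x = y.
Proof.
move=> xy; apply/eqP; rewrite -subr_eq0; apply/eqP/cd_normsq_eq0.
by rewrite cd_dotE cd_dotDr cd_dotNr xy subrr.
Qed.

Lemma cd_dot_conj {k} (x y : A k) : cd_dot (cd_conj x) (cd_conj y) = cd_dot x y.
Proof.
by elim: k x y => //= k IH x y; rewrite IH cd_dotNl cd_dotNr opprK.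
Qed.

Lemma cd_normsq_conj {k} (x : A k) : cd_normsq (cd_conj x) = cd_normsq x.
Proof. by rewrite !cd_dotE cd_dot_conj. Qed.

(** Left multiplication by [conj y] is adjoint to left multiplication by [y];
    this needs no associativity and holds at every stage of the doubling. *)
Lemma cd_dot_mulr {k} (x y z : A k) :
  cd_dot x (cd_mul y z) = cd_dot (cd_mul (cd_conj y) x) z.
Proof.
elim: k x y z => [|k IH] /= x y z.
  change (x * (y * z) = y * x * z :> R); ring.
have IH' u v w : cd_dot u (@cd_mul R k v w) = cd_dot (cd_mul u (cd_conj w)) v.
  by rewrite -cd_dot_conj cd_conj_mul IH -[RHS]cd_dot_conj cd_conj_mul.
rewrite !cd_dotDr cd_dotNr cd_mulNl cd_mulNr !cd_dotDl !cd_dotNl opprK.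
rewrite IH (IH' x.1) (IH' x.2) (IH x.2).
rewrite -(cd_dot_conj (cd_mul x.1 _)) -(cd_dot_conj (cd_mul _ x.2)).
rewrite !cd_conj_mul !cd_conjK.
ring.
Qed.

Lemma cd_dot_mull {k} (x y z : A k) :
  cd_dot x (cd_mul y z) = cd_dot (cd_mul x (cd_conj z)) y.
Proof.
by rewrite -cd_dot_conj cd_conj_mul cd_dot_mulr -[RHS]cd_dot_conj cd_conj_mul.
Qed.

Lemma cd_addr_conj {k} (x : A k) :
  x + cd_conj x = (2 * cd_dot (cd_one k) x) *: cd_one k.
Proof.
elim: k x => [|k IH] /= x.
  change (x + x = 2 * (1 * x) * 1 :> R); ring.
case: x => x y /=; rewrite cd_dot0l addr0.
by congr pair => /=; rewrite ?scaler0 ?subrr // IH.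
Qed.

Lemma cd_imaginary_dot {k} (v : A k) :
  imaginary v -> cd_dot (cd_one k) v = 0.
Proof.
move=> /eqP iv; have := cd_dot_conj (cd_one k) v.
rewrite cd_conj_one -[cd_conj v]opprK -iv cd_dotNr => /eqP.
by rewrite -subr_eq0 -opprD oppr_eq0 -mulr2n mulrn_eq0 /= => /eqP.
Qed.

Lemma pair_eq {S T : Type} (x y : S * T) : x.1 = y.1 -> x.2 = y.2 -> x = y.
Proof. by case: x y => a b [c d] /= -> ->. Qed.

(** Up to the quaternions the product is associative. *)
Lemma cd_mulA {k} (k2 : (k <= 2)%N) (x y z : A k) :
  cd_mul x (cd_mul y z) = cd_mul (cd_mul x y) z.
Proof.
case: k k2 x y z => [|[|[|//]]] _ /=.
- exact: mulrA.
- by move=> [a b] [c d] [e f]; apply: pair_eq => /=; ring.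
- move=> [[a a'] [b b']] [[c c'] [d d']] [[e e'] [f f']].
  by do 2![apply: pair_eq => /=]; ring.
Qed.

(** The instance of alternativity that is left for the octonions; it is checked
    in coordinates. Together with the adjunction it yields multiplicativity of
    the norm. *)
Lemma cd_mul_conjr {k} (k3 : (k <= 3)%N) (x a : A k) :
  cd_mul (cd_mul x a) (cd_conj a) = cd_normsq a *: x.
Proof.
have scE (r s : R) : r *: (s : R^o) = r * s by [].
case: k k3 x a => [|[|[|[|//]]]] _ /=.
- move=> x a; rewrite scE; ring.
- by move=> [x y] [a b]; apply: pair_eq => /=; rewrite scE; ring.
- move=> [[x x'] [y y']] [[a a'] [b b']].
  by do 2![apply: pair_eq => /=]; rewrite scE; ring.
- move=> [[[x x'] [y y']] [[z z'] [t t']]] [[[a a'] [b b']] [[c c'] [d d']]].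
  by do 3![apply: pair_eq => /=]; rewrite scE; ring.
Qed.

Lemma cd_normsqM {k} (k3 : (k <= 3)%N) (x y : A k) :
  cd_normsq (cd_mul x y) = cd_normsq x * cd_normsq y.
Proof.
by rewrite cd_dotE cd_dot_mull cd_mul_conjr // cd_dotZl -cd_dotE mulrC.
Qed.

Lemma cd_conj_mulr {k} (k3 : (k <= 3)%N) (a x : A k) :
  cd_mul (cd_conj a) (cd_mul a x) = cd_normsq a *: x.
Proof.
apply: (inv_inj (@cd_conjK R k)).
rewrite !cd_conj_mul cd_conjZ -{2}[a]cd_conjK -(cd_normsq_conj a).
by rewrite -(cd_mul_conjr k3 (cd_conj x) (cd_conj a)) cd_conjK.
Qed.

(** Pythagoras: real scalars are orthogonal to imaginary elements. *)
Lemma cd_normsq_real_imag {k} (s : R) (v : A k) : imaginary v ->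
  cd_normsq (s *: cd_one k + v) = s ^+ 2 + cd_normsq v.
Proof.
move=> iv; rewrite cd_normsqD cd_dotZl cd_imaginary_dot // cd_normsqZ.
by rewrite cd_normsq_one !mulr0 addr0 mulr1.
Qed.

(** Decomposition into real and imaginary part. *)
Lemma cd_decomp {k} (x : A k) :
  x = cd_dot (cd_one k) x *: cd_one k + 2^-1 *: (x - cd_conj x).
Proof.
apply: (@scalerI _ _ 2); first by rewrite pnatr_eq0.
rewrite scalerDr !scalerA divff ?pnatr_eq0// scale1r -cd_addr_conj.
by rewrite addrACA subrr addr0 -mulr2n scaler_nat.
Qed.

Lemma cd_norm_ge0 {k} (x : A k) : 0 <= cd_norm x.
Proof. exact: sqrtr_ge0. Qed.

Lemma cd_norm_sqr {k} (x : A k) : cd_norm x ^+ 2 = cd_normsq x.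
Proof. by rewrite sqr_sqrtr ?cd_normsq_ge0. Qed.

Lemma cd_dot_le {k} (x y : A k) : cd_dot x y <= cd_norm x * cd_norm y.
Proof.
have [x0|x0] := eqVneq (cd_norm x) 0.
  have : cd_normsq x = 0 by rewrite -cd_norm_sqr x0 expr0n.
  by move/cd_normsq_eq0 => ->; rewrite cd_dot0l mulr_ge0 ?cd_norm_ge0.
have [y0|y0] := eqVneq (cd_norm y) 0.
  have : cd_normsq y = 0 by rewrite -cd_norm_sqr y0 expr0n.
  by move/cd_normsq_eq0 => ->; rewrite cd_dot0r mulr_ge0 ?cd_norm_ge0.
have xp : 0 < cd_norm x by rewrite lt0r x0 cd_norm_ge0.
have yp : 0 < cd_norm y by rewrite lt0r y0 cd_norm_ge0.
have := cd_normsq_ge0 (cd_norm y *: x + - (cd_norm x *: y)).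
rewrite cd_normsqD cd_normsqN !cd_normsqZ cd_dotNr cd_dotZl cd_dotZr.
rewrite -!cd_norm_sqr => H.
rewrite -(ler_pM2l (mulr_gt0 xp yp)); nra.
Qed.

Lemma cd_normD {k} (x y : A k) : cd_norm (x + y) <= cd_norm x + cd_norm y.
Proof.
rewrite -ler_sqr ?nnegrE ?addr_ge0 ?cd_norm_ge0 // cd_norm_sqr cd_normsqD sqrrD.
by rewrite !cd_norm_sqr lerD2r lerD2l mulr2n mulrDl mul1r lerD // cd_dot_le.
Qed.

Lemma cd_normZ {k} (a : R) (x : A k) : cd_norm (a *: x) = `|a| * cd_norm x.
Proof. by rewrite /cd_norm cd_normsqZ sqrtrM ?sqr_ge0 // sqrtr_sqr. Qed.

Lemma cd_normN {k} (x : A k) : cd_norm (- x) = cd_norm x.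
Proof. by rewrite /cd_norm cd_normsqN. Qed.

Lemma cd_norm_conj {k} (x : A k) : cd_norm (cd_conj x) = cd_norm x.
Proof. by rewrite /cd_norm cd_normsq_conj. Qed.

Lemma cd_norm0 {k} : cd_norm (0 : A k) = 0.
Proof. by rewrite /cd_norm cd_dotE cd_dot0l sqrtr0. Qed.

Lemma cd_normM {k} (k3 : (k <= 3)%N) (x y : A k) :
  cd_norm (cd_mul x y) = cd_norm x * cd_norm y.
Proof. by rewrite /cd_norm cd_normsqM // sqrtrM ?cd_normsq_ge0. Qed.

End CayleyDickson.

(** * The Heisenberg group *)

Section Heisenberg.
Context {R : realType} {K : division_algebra} {n : nat}.
Local Notation A := (carrier R K).
Local Notation one := (cd_one (doublings K) : carrier R K).
Local Notation V := ('rV[carrier R K]_(n.-1)).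
Local Notation H := (heis R K n).
Local Notation o := (heis_origin R K n).

Lemma doublings_le3 : (doublings K <= 3)%N.
Proof. by case: K. Qed.
Local Notation K3 := doublings_le3.

(** Multiplication of a row by a real scalar, coordinatewise. *)
Definition vscale (r : R) (z : V) : V := map_mx (fun x : A => r *: x) z.

(** Right multiplication of a row by an element of the algebra. *)
Definition vmulr (z : V) (a : A) : V := map_mx (fun x : A => cd_mul x a) z.

(** The hermitian form, conjugate-linear in the first argument. The cocycle
    [omega z w] is the imaginary part of [herm w z]. *)
Definition herm (z w : V) : A :=
  \sum_(i < n.-1) cd_mul (cd_conj (z 0 i)) (w 0 i).

Lemma imaginaryZ (r : R) (v : imag R K) :
  imaginary (r *: imag_val v : cayley_dickson R (doublings K)).
Proof.
by case: v => v /= /eqP iv; rewrite /imaginary cd_conjZ -scalerN -iv.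
Qed.

(** Real scaling of imaginary elements. *)
Definition iscale (r : R) (v : imag R K) : imag R K := Imag (imaginaryZ r v).

Lemma imag_iscale (r : R) (v : imag R K) :
  imag_val (iscale r v) = r *: imag_val v.
Proof. by []. Qed.

Lemma imag_valD (u v : imag R K) : imag_val (u + v) = imag_val u + imag_val v.
Proof. exact: (raddfD (val : imag R K -> A)). Qed.

Lemma imag_valN (u : imag R K) : imag_val (- u) = - imag_val u.
Proof. exact: (raddfN (val : imag R K -> A)). Qed.

Lemma imag_val0 : imag_val (0 : imag R K) = 0.
Proof. exact: (raddf0 (val : imag R K -> A)). Qed.

Lemma imag_val_inj (u v : imag R K) : imag_val u = imag_val v -> u = v.
Proof. exact: val_inj. Qed.

Lemma imag_conj (v : imag R K) : cd_conj (imag_val v) = - imag_val v.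
Proof. by case: v => v /= /eqP iv; rewrite {2}iv opprK. Qed.

Lemma vec_normsqE (z : V) : vec_normsq z = \sum_i cd_normsq (z 0 i).
Proof. by apply: eq_bigr => i _; rewrite cd_norm_sqr. Qed.

Lemma vec_normsq_ge0 (z : V) : 0 <= vec_normsq z.
Proof. by apply: sumr_ge0 => i _; rewrite sqr_ge0. Qed.

Lemma vec_normsq_eq0 (z : V) : vec_normsq z = 0 -> z = 0.
Proof.
rewrite vec_normsqE => /eqP; rewrite psumr_eq0; last first.
  by move=> i _; exact: cd_normsq_ge0.
move=> /allP zi; apply/matrixP => i j; rewrite (ord1 i) mxE.
by apply: cd_normsq_eq0; apply/eqP/zi; rewrite mem_index_enum.
Qed.

Lemma vec_normsq_gt0 (z : V) : z <> 0 -> 0 < vec_normsq z.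
Proof.
move=> z0; rewrite lt_neqAle vec_normsq_ge0 andbT eq_sym.
by apply: contra_notN z0 => /eqP /vec_normsq_eq0.
Qed.

Lemma vec_normsqN (z : V) : vec_normsq (- z) = vec_normsq z.
Proof.
by rewrite !vec_normsqE; apply: eq_bigr => i _; rewrite mxE cd_normsqN.
Qed.

Lemma vec_normsq_vscale (r : R) (z : V) :
  vec_normsq (vscale r z) = r ^+ 2 * vec_normsq z.
Proof.
rewrite !vec_normsqE mulr_sumr; apply: eq_bigr => i _.
by rewrite mxE cd_normsqZ.
Qed.

Lemma vec_normsq_vmulr (z : V) (a : A) :
  vec_normsq (vmulr z a) = vec_normsq z * cd_normsq a.
Proof.
rewrite !vec_normsqE mulr_suml; apply: eq_bigr => i _.
by rewrite mxE (cd_normsqM K3).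
Qed.

Lemma hermDl (z z' w : V) : herm (z + z') w = herm z w + herm z' w.
Proof.
rewrite /herm -big_split; apply: eq_bigr => i _.
by rewrite mxE cd_conjD cd_mulDl.
Qed.

Lemma hermDr (z w w' : V) : herm z (w + w') = herm z w + herm z w'.
Proof.
rewrite /herm -big_split; apply: eq_bigr => i _.
by rewrite mxE cd_mulDr.
Qed.

Lemma hermNl (z w : V) : herm (- z) w = - herm z w.
Proof.
rewrite /herm -sumrN; apply: eq_bigr => i _.
by rewrite mxE cd_conjN cd_mulNl.
Qed.

Lemma hermNr (z w : V) : herm z (- w) = - herm z w.
Proof.
by rewrite /herm -sumrN; apply: eq_bigr => i _; rewrite mxE cd_mulNr.
Qed.

Lemma hermZl (r : R) (z w : V) : herm (vscale r z) w = r *: herm z w.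
Proof.
rewrite /herm scaler_sumr; apply: eq_bigr => i _.
by rewrite mxE cd_conjZ cd_mulZl.
Qed.

Lemma hermZr (r : R) (z w : V) : herm z (vscale r w) = r *: herm z w.
Proof.
by rewrite /herm scaler_sumr; apply: eq_bigr => i _; rewrite mxE cd_mulZr.
Qed.

Lemma cd_conj_sum (F : 'I_n.-1 -> A) :
  cd_conj (\sum_i F i) = \sum_i cd_conj (F i).
Proof.
apply: (big_morph (@cd_conj R (doublings K))); first exact: cd_conjD.
exact: cd_conj0.
Qed.

Lemma cd_dot_sum (x : A) (F : 'I_n.-1 -> A) :
  cd_dot x (\sum_i F i) = \sum_i cd_dot x (F i).
Proof.
apply: (big_morph (@cd_dot R (doublings K) x)); first exact: cd_dotDr.
exact: cd_dot0r.
Qed.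

Lemma conj_herm (z w : V) : cd_conj (herm z w) = herm w z.
Proof.
by rewrite /herm cd_conj_sum; apply: eq_bigr => i _; rewrite cd_conj_mul cd_conjK.
Qed.

Lemma imag_val_omega (z w : V) :
  imag_val (omega z w) = 2^-1 *: (herm w z - herm z w).
Proof. by rewrite /omega /= -/(herm w z) conj_herm. Qed.

Lemma vec_normsqD (z w : V) :
  vec_normsq (z + w) = vec_normsq z + 2 * cd_dot one (herm z w) + vec_normsq w.
Proof.
rewrite !vec_normsqE cd_dot_sum mulr_sumr -!big_split; apply: eq_bigr => i _ /=.
rewrite mxE cd_normsqD; congr (_ + _ * _ + _).
by rewrite cd_dot_mulr cd_conjK cd_mul_one.
Qed.

Lemma herm_self (z : V) : herm z z = vec_normsq z *: one.
Proof.
rewrite /herm vec_normsqE scaler_suml; apply: eq_bigr => i _.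
by rewrite -[X in cd_mul _ X]cd_mul_one (cd_conj_mulr K3).
Qed.

(** How the hermitian form reacts to right multiplication of its arguments. For
    an associative algebra [herm (z a) (w b)] is [conj a * herm z w * b]; for
    octonions that formula fails, but the two inner products below and the norm
    in [normsq_herm_vmulr] still behave as if it held. *)
Lemma dot_conj_herm_vmulr (a b : A) (z w : V) :
  cd_dot (cd_conj a) (herm (vmulr z a) (vmulr w b)) =
  cd_normsq a * cd_dot (cd_conj b) (herm z w).
Proof.
rewrite /herm !cd_dot_sum mulr_sumr; apply: eq_bigr => i _; rewrite !mxE.
rewrite cd_dot_mulr cd_conjK (cd_mul_conjr K3) cd_dotZl; congr (_ * _).
by rewrite cd_dot_mulr -cd_dot_conj cd_conj_mul cd_conjK cd_dotC.
Qed.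

Lemma dot_herm_vmulr (a b : A) (z w : V) :
  cd_dot b (herm (vmulr z a) (vmulr w b)) =
  cd_normsq b * cd_dot a (herm z w).
Proof.
rewrite -cd_dot_conj !conj_herm dot_conj_herm_vmulr; congr (_ * _).
by rewrite -cd_dot_conj conj_herm cd_conjK.
Qed.

(** Associativity settles the case of several coordinates; over the octonions
    there is only one coordinate and multiplicativity of the norm suffices. *)
Lemma normsq_herm_vmulr (hO : K = Octonions -> n = 2%N) (a b : A) (z w : V) :
  cd_normsq (herm (vmulr z a) (vmulr w b)) =
  cd_normsq a * cd_normsq b * cd_normsq (herm z w).
Proof.
have [k2|KO] : (doublings K <= 2)%N \/ K = Octonions.
  by case: (K); [left|left|left|right].
- have -> : herm (vmulr z a) (vmulr w b) =
      cd_mul (cd_mul (cd_conj a) (herm z w)) b.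
    have sumr (F : 'I_n.-1 -> A) : cd_mul (cd_conj a) (\sum_i F i) =
        \sum_i cd_mul (cd_conj a) (F i).
      apply: (big_morph (cd_mul (cd_conj a))); first exact: cd_mulDr.
      exact: cd_mul0r.
    have suml (F : 'I_n.-1 -> A) : cd_mul (\sum_i F i) b =
        \sum_i cd_mul (F i) b.
      apply: (big_morph (fun x => cd_mul x b)) => [x y|]; first exact: cd_mulDl.
      exact: cd_mul0l.
    rewrite /herm sumr suml; apply: eq_bigr => i _.
    by rewrite !mxE cd_conj_mul !(cd_mulA k2).
  by rewrite !(cd_normsqM K3) cd_normsq_conj mulrAC.
- have n1 : (0 < n.-1)%N by rewrite (hO KO).
  have single (F : 'I_n.-1 -> A) : \sum_i F i = F (Ordinal n1).
    rewrite (bigD1 (Ordinal n1)) //= big1 ?addr0 // => i.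
    by rewrite -val_eqE /=; move: (ltn_ord i); rewrite {2}(hO KO) ltnS leqn0 => ->.
  rewrite /herm !single !mxE cd_conj_mul !(cd_normsqM K3) !cd_normsq_conj.
  by ring.
Qed.

(** The element [|z|^2 + v] of the algebra attached to the point [(z, v)]. Its
    norm is the square of the gauge. *)
Definition cgauge (p : H) : A := vec_normsq p.1 *: one + imag_val p.2.

(** The polarization of [cgauge]: it is [cgauge] of the quotient [q^-1 * p], so
    its norm is the square of the distance between [p] and [q]. *)
Definition cpolar (p q : H) : A :=
  cgauge p + cd_conj (cgauge q) - 2 *: herm p.1 q.1.

Lemma normsq_cgauge (p : H) :
  cd_normsq (cgauge p) = vec_normsq p.1 ^+ 2 + cd_normsq (imag_val p.2).
Proof. by rewrite cd_normsq_real_imag //; exact: imag_valP. Qed.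

Lemma koranyi_gaugeE (p : H) : koranyi_gauge p = cd_normsq (cgauge p) `^ 4^-1.
Proof. by rewrite /koranyi_gauge cd_norm_sqr normsq_cgauge. Qed.

Lemma heis_eq (p q : H) : p.1 = q.1 -> p.2 = q.2 -> p = q.
Proof. by case: p q => a b [c d] /= -> ->. Qed.

Lemma imag_heis_mul (p q : H) : imag_val (heis_mul p q).2 =
  imag_val p.2 + imag_val q.2 + (herm q.1 p.1 - herm p.1 q.1).
Proof.
have -> : (heis_mul p q).2 = p.2 + q.2 + omega p.1 q.1 *+ 2 by [].
rewrite mulr2n !imag_valD imag_val_omega; congr (_ + _).
by rewrite -mulr2n -scaler_nat scalerA mulfV ?pnatr_eq0 // scale1r.
Qed.

Lemma imag_heis_inv (p : H) : imag_val (heis_inv p).2 = - imag_val p.2.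
Proof. exact: imag_valN. Qed.

Lemma cgauge_quotient (p q : H) :
  cgauge (heis_mul (heis_inv q) p) = cpolar p q.
Proof.
rewrite /cgauge imag_heis_mul imag_heis_inv.
have -> : (heis_mul (heis_inv q) p).1 = - q.1 + p.1 by [].
have -> : (heis_inv q).1 = - q.1 by [].
rewrite vec_normsqD vec_normsqN !hermNl hermNr.
have -> : cd_dot one (- herm q.1 p.1) = - cd_dot one (herm p.1 q.1).
  by rewrite cd_dotNr -cd_dot_conj cd_conj_one conj_herm.
rewrite /cpolar /cgauge cd_conjD cd_conjZ cd_conj_one imag_conj.
rewrite [in X in _ = _ - X](cd_decomp (herm p.1 q.1)) conj_herm.
apply: cd_dot_ext => w; rewrite !(cd_dotDr, cd_dotZr, cd_dotNr).
by field.
Qed.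

(** The fourth power of the gauge, free of roots. *)
Definition hnorm4 (p : H) : R := cd_normsq (cgauge p).

Lemma hnorm4_ge0 (p : H) : 0 <= hnorm4 p.
Proof. exact: cd_normsq_ge0. Qed.

Lemma hnorm4_eq0 (p : H) : hnorm4 p = 0 -> p = o.
Proof.
move=> /eqP; rewrite /hnorm4 normsq_cgauge paddr_eq0 ?sqr_ge0 ?cd_normsq_ge0//.
rewrite sqrf_eq0 => /andP[/eqP /vec_normsq_eq0 z0 /eqP /cd_normsq_eq0 v0].
case: p z0 v0 => z v /= -> v0; congr pair; apply: imag_val_inj.
by rewrite /= v0.
Qed.

Lemma hnorm4_gt0 (p : H) : p <> o -> 0 < hnorm4 p.
Proof.
move=> po; rewrite lt_neqAle hnorm4_ge0 andbT eq_sym.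
by apply: contra_notN po => /eqP /hnorm4_eq0.
Qed.

Lemma koranyiE (p q : H) : koranyi p q = cd_normsq (cpolar p q) `^ 4^-1.
Proof. by rewrite /koranyi koranyi_gaugeE cgauge_quotient. Qed.

Lemma conj_cpolar (p q : H) : cd_conj (cpolar p q) = cpolar q p.
Proof.
rewrite /cpolar cd_conjB cd_conjD cd_conjK cd_conjZ conj_herm.
by rewrite (addrC (cd_conj _)).
Qed.

Lemma omegaDl (z z' w : V) : omega (z + z') w = omega z w + omega z' w.
Proof.
apply: imag_val_inj; rewrite imag_valD !imag_val_omega hermDl hermDr.
by rewrite -scalerDr opprD addrACA.
Qed.

Lemma omegaDr (z w w' : V) : omega z (w + w') = omega z w + omega z w'.
Proof.
apply: imag_val_inj; rewrite imag_valD !imag_val_omega hermDl hermDr.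
by rewrite -scalerDr opprD addrACA.
Qed.

Lemma omega_self (z : V) : omega z z = 0.
Proof. by apply: imag_val_inj; rewrite imag_val_omega subrr scaler0 imag_val0. Qed.

Lemma omegaNl (z w : V) : omega (- z) w = - omega z w.
Proof.
apply: imag_val_inj; rewrite imag_valN !imag_val_omega hermNl hermNr.
by rewrite -scalerN opprD.
Qed.

Lemma omegaNr (z w : V) : omega z (- w) = - omega z w.
Proof.
apply: imag_val_inj; rewrite imag_valN !imag_val_omega hermNl hermNr.
by rewrite -scalerN opprD.
Qed.

Lemma omega0l (w : V) : omega 0 w = 0.
Proof.
have /eqP := omegaDl 0 0 w.
by rewrite addr0 -subr_eq0 opprD addNKr oppr_eq0 => /eqP.
Qed.

Lemma omega0r (w : V) : omega w 0 = 0.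
Proof.
have /eqP := omegaDr w 0 0.
by rewrite addr0 -subr_eq0 opprD addNKr oppr_eq0 => /eqP.
Qed.

Lemma heis_mulA (p q r : H) :
  heis_mul p (heis_mul q r) = heis_mul (heis_mul p q) r.
Proof.
have E (x y : H) : (heis_mul x y).1 = x.1 + y.1 by [].
apply: heis_eq; first exact: addrA.
apply: imag_val_inj; rewrite !imag_heis_mul !E !hermDl !hermDr.
apply: cd_dot_ext => w; rewrite !(cd_dotDr, cd_dotNr).
by ring.
Qed.

Lemma heis_mul0l (p : H) : heis_mul o p = p.
Proof. by case: p => z v; rewrite /heis_mul /= omega0l mul0rn !add0r addr0. Qed.

Lemma heis_mul0r (p : H) : heis_mul p o = p.
Proof. by case: p => z v; rewrite /heis_mul /= omega0r mul0rn !addr0. Qed.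

Lemma heis_mulVr (p : H) : heis_mul (heis_inv p) p = o.
Proof. by rewrite /heis_mul /= omegaNl omega_self oppr0 mul0rn addr0 !addNr. Qed.

Lemma heis_mulrV (p : H) : heis_mul p (heis_inv p) = o.
Proof. by rewrite /heis_mul /= omegaNr omega_self oppr0 mul0rn addr0 !subrr. Qed.

Lemma heis_mulK (p q : H) : heis_mul (heis_inv p) (heis_mul p q) = q.
Proof. by rewrite heis_mulA heis_mulVr heis_mul0l. Qed.

Lemma heis_mulVK (p q : H) : heis_mul p (heis_mul (heis_inv p) q) = q.
Proof. by rewrite heis_mulA heis_mulrV heis_mul0l. Qed.

Lemma heis_invM (p q : H) :
  heis_inv (heis_mul p q) = heis_mul (heis_inv q) (heis_inv p).
Proof.
have E r : heis_mul (heis_mul (heis_inv q) (heis_inv p)) (heis_mul p r) =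
    heis_mul (heis_inv q) r by rewrite -heis_mulA heis_mulK.
rewrite -[LHS]heis_mul0l -(heis_mulVr q) -(E q) -heis_mulA heis_mulrV.
by rewrite heis_mul0r.
Qed.

(** The dilation [(z, v) |-> (r z, r^2 v)], a group automorphism. *)
Definition dil (r : R) (p : H) : H := (vscale r p.1, iscale (r ^+ 2) p.2).

Lemma vscaleD (r : R) (z w : V) : vscale r (z + w) = vscale r z + vscale r w.
Proof. by apply/matrixP => i j; rewrite !mxE scalerDr. Qed.

Lemma vscaleA (r s : R) (z : V) : vscale r (vscale s z) = vscale (r * s) z.
Proof. by apply/matrixP => i j; rewrite !mxE scalerA. Qed.

Lemma vscale1 (z : V) : vscale 1 z = z.
Proof. by apply/matrixP => i j; rewrite !mxE scale1r. Qed.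

Lemma vscaleDl (r s : R) (z : V) : vscale (r + s) z = vscale r z + vscale s z.
Proof. by apply/matrixP => i j; rewrite !mxE scalerDl. Qed.

Lemma iscaleA (r s : R) (v : imag R K) :
  iscale r (iscale s v) = iscale (r * s) v.
Proof. by apply: imag_val_inj; rewrite /= scalerA. Qed.

Lemma iscale1 (v : imag R K) : iscale 1 v = v.
Proof. by apply: imag_val_inj; rewrite /= scale1r. Qed.

Lemma dil_mul (r s : R) (p : H) : dil r (dil s p) = dil (r * s) p.
Proof. by rewrite /dil /= vscaleA iscaleA exprMn. Qed.

Lemma dil1 (p : H) : dil 1 p = p.
Proof. by case: p => z v; rewrite /dil vscale1 expr1n iscale1. Qed.

Lemma dil_inj (r : R) : 0 < r -> injective (dil r).
Proof.
move=> r0; apply: (can_inj (g := dil r^-1)) => p.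
by rewrite dil_mul mulVf ?gt_eqF // dil1.
Qed.

Lemma dil_heis_mul (r : R) (p q : H) :
  dil r (heis_mul p q) = heis_mul (dil r p) (dil r q).
Proof.
apply: heis_eq; first exact: vscaleD.
have E x : imag_val (dil r x).2 = r ^+ 2 *: imag_val x.2 by [].
have E1 x : (dil r x).1 = vscale r x.1 by [].
apply: imag_val_inj; rewrite E !imag_heis_mul !E !E1 !hermZl !hermZr.
apply: cd_dot_ext => w; rewrite !(cd_dotDr, cd_dotZr, cd_dotNr) /=.
by ring.
Qed.

Lemma cgauge_dil (r : R) (p : H) : cgauge (dil r p) = r ^+ 2 *: cgauge p.
Proof. by rewrite /cgauge /= vec_normsq_vscale scalerDr scalerA. Qed.

Lemma cpolar_dil (r : R) (p q : H) :
  cpolar (dil r p) (dil r q) = r ^+ 2 *: cpolar p q.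
Proof.
rewrite /cpolar !cgauge_dil cd_conjZ /= hermZl hermZr.
apply: cd_dot_ext => w; rewrite !(cd_dotDr, cd_dotZr, cd_dotNr) /=.
by ring.
Qed.

Lemma cpolar_mull (x p q : H) :
  cpolar (heis_mul x p) (heis_mul x q) = cpolar p q.
Proof.
by rewrite -!cgauge_quotient heis_invM -heis_mulA heis_mulK.
Qed.

(** The inversion [(z, v) |-> (- z a / |a|^2, - v / |a|^2)], with [a] the element
    [cgauge (z, v)]. Since [0^-1 = 0], the origin is sent to
    itself; [einv] sends it to infinity instead. *)
Definition hinv (p : H) : H :=
  let s := (hnorm4 p)^-1 in
  (vmulr p.1 (- s *: cgauge p), iscale (- s) p.2).

Lemma vmulrZ (r : R) (z : V) (a : A) : vmulr z (r *: a) = vscale r (vmulr z a).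
Proof. by apply/matrixP => i j; rewrite !mxE cd_mulZr. Qed.

Lemma vmulr_vscale (r : R) (z : V) (a : A) :
  vmulr (vscale r z) a = vscale r (vmulr z a).
Proof. by apply/matrixP => i j; rewrite !mxE cd_mulZl. Qed.

Lemma vmulr_conj (z : V) (a : A) :
  vmulr (vmulr z a) (cd_conj a) = vscale (cd_normsq a) z.
Proof. by apply/matrixP => i j; rewrite !mxE (cd_mul_conjr K3). Qed.

Lemma cgauge_hinv (p : H) : p <> o ->
  cgauge (hinv p) = (hnorm4 p)^-1 *: cd_conj (cgauge p).
Proof.
move=> /hnorm4_gt0 p0.
rewrite /cgauge /= vec_normsq_vmulr cd_normsqZ -/(hnorm4 p) sqrrN expr2.
rewrite -mulrA mulVf ?gt_eqF // mulr1 cd_conjD cd_conjZ cd_conj_one imag_conj.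
by rewrite scalerDr scalerA (mulrC (vec_normsq _)) scalerN scaleNr.
Qed.

Lemma hnorm4_hinv (p : H) : p <> o -> hnorm4 (hinv p) = (hnorm4 p)^-1.
Proof.
move=> p0; rewrite /hnorm4 cgauge_hinv // cd_normsqZ cd_normsq_conj.
by rewrite expr2 -/(hnorm4 p) -mulrA mulVf ?mulr1 // gt_eqF // hnorm4_gt0.
Qed.

Lemma hnorm4_o : hnorm4 o = 0.
Proof.
rewrite /hnorm4 normsq_cgauge /= vec_normsqE big1 ?imag_val0; last first.
  by move=> i _; rewrite mxE cd_dotE cd_dot0l.
by rewrite expr0n /= add0r cd_dotE cd_dot0l.
Qed.

Lemma hinv_neq0 (p : H) : p <> o -> hinv p <> o.
Proof.
move=> p0 E; have := hnorm4_hinv _ p0; rewrite E hnorm4_o => /eqP.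
by rewrite eq_sym invr_eq0 gt_eqF // hnorm4_gt0.
Qed.

Lemma hinvK (p : H) : p <> o -> hinv (hinv p) = p.
Proof.
move=> p0; have s0 : hnorm4 p != 0 by rewrite gt_eqF // hnorm4_gt0.
rewrite {1}/hinv hnorm4_hinv // invrK cgauge_hinv // /hinv /=.
case: p p0 s0 => z v p0 s0; congr pair; last first.
  by rewrite iscaleA mulrNN mulfV // iscale1.
rewrite !vmulrZ vmulr_vscale vmulr_conj !vscaleA /=.
rewrite -/(hnorm4 (z, v)).
rewrite -[RHS]vscale1; congr (vscale _ _); by field.
Qed.

(** The inversion divides the fourth power of the distance of two points by the
    fourth powers of their gauges. Expanding the square norm leaves exactly the
    terms computed by the three lemmas on [herm (z a) (w b)]. *)
Lemma normsq_cpolar_hinv (hO : K = Octonions -> n = 2%N) (p q : H) :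
  p <> o -> q <> o ->
  cd_normsq (cpolar (hinv p) (hinv q)) =
  cd_normsq (cpolar p q) / (hnorm4 p * hnorm4 q).
Proof.
move=> p0 q0; have := hnorm4_gt0 _ p0; have := hnorm4_gt0 _ q0.
have E x : (hinv x).1 = vscale (- (hnorm4 x)^-1) (vmulr x.1 (cgauge x)).
  exact: vmulrZ.
rewrite /cpolar !cgauge_hinv // cd_conjZ cd_conjK !E hermZl hermZr /hnorm4.
have h1 := dot_conj_herm_vmulr (cgauge p) (cgauge q) p.1 q.1.
have h2 := dot_herm_vmulr (cgauge p) (cgauge q) p.1 q.1.
have h3 := normsq_herm_vmulr hO (cgauge p) (cgauge q) p.1 q.1.
move: (herm (vmulr _ _) _) h1 h2 h3 => h'; move: (herm p.1 q.1) => h.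
move: (cgauge p) (cgauge q) => a b h1 h2 h3 b0 a0.
rewrite !scalerA !(cd_normsqD, cd_normsqN, cd_normsqZ).
rewrite !(cd_dotNr, cd_dotZr, cd_dotZl, cd_dotDl).
rewrite !cd_normsq_conj h1 h2 h3 -(cd_dot_conj a (cd_conj b)) cd_conjK.
by field; rewrite !gt_eqF.
Qed.

End Heisenberg.

(** * The Koranyi metric *)

Section Koranyi.
Context {R : realType} {K : division_algebra} {n : nat}.
Local Notation V := ('rV[carrier R K]_(n.-1)).
Local Notation H := (heis R K n).
Local Notation o := (heis_origin R K n).
Local Notation k := (@koranyi R K n).
Local Notation g := (@koranyi_gauge R K n).

Lemma gauge_ge0 (p : H) : 0 <= g p.
Proof. exact: powR_ge0. Qed.

Lemma koranyi_ge0 (p q : H) : 0 <= k p q.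
Proof. exact: powR_ge0. Qed.

Lemma koranyi_quotient (p q : H) : k p q = g (heis_mul (heis_inv q) p).
Proof. by []. Qed.

Lemma powR_root4 (x : R) : 0 <= x -> (x `^ 4^-1) ^+ 4 = x.
Proof.
by move=> x0; rewrite -powR_mulrn ?powR_ge0 // -powRrM mulVf // powRr1.
Qed.

Lemma gauge_exp4 (p : H) : g p ^+ 4 = hnorm4 p.
Proof. by rewrite koranyi_gaugeE powR_root4 // hnorm4_ge0. Qed.

Lemma koranyi_exp4 (p q : H) : k p q ^+ 4 = cd_normsq (cpolar p q).
Proof. by rewrite koranyiE powR_root4 // cd_normsq_ge0. Qed.

Lemma eq_exp4 (x y : R) : 0 <= x -> 0 <= y -> x ^+ 4 = y ^+ 4 -> x = y.
Proof. by move=> x0 y0 /eqP; rewrite eqrXn2 // => /eqP. Qed.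

Lemma gauge_sqr (p : H) : g p ^+ 2 = cd_norm (cgauge p).
Proof.
apply/eqP; rewrite -(@eqrXn2 _ 2) ?sqr_ge0 ?cd_norm_ge0 // -exprM gauge_exp4.
by rewrite cd_norm_sqr.
Qed.

Lemma gauge_eq0 (p : H) : g p = 0 -> p = o.
Proof. by move=> p0; apply: hnorm4_eq0; rewrite -gauge_exp4 p0 expr0n. Qed.

Lemma gauge_gt0 (p : H) : p <> o -> 0 < g p.
Proof.
move=> po; rewrite lt_neqAle gauge_ge0 andbT eq_sym.
by apply: contra_notN po => /eqP /gauge_eq0.
Qed.

Lemma gauge_o : g o = 0.
Proof.
apply: eq_exp4; [exact: gauge_ge0|exact: lexx|].
by rewrite gauge_exp4 hnorm4_o expr0n.
Qed.

Lemma koranyi_sym (p q : H) : k p q = k q p.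
Proof.
apply: eq_exp4; [exact: koranyi_ge0|exact: koranyi_ge0|].
rewrite !koranyi_exp4 -(conj_cpolar q p).
by rewrite cd_normsq_conj.
Qed.

Lemma heis_inv0 : heis_inv o = o.
Proof. by rewrite /heis_inv /= !oppr0. Qed.

Lemma koranyi_or (p : H) : k p o = g p.
Proof. by rewrite koranyi_quotient heis_inv0 heis_mul0l. Qed.

Lemma koranyi_ol (p : H) : k o p = g p.
Proof. by rewrite koranyi_sym koranyi_or. Qed.

Lemma koranyi_mull (x p q : H) : k (heis_mul x p) (heis_mul x q) = k p q.
Proof. by rewrite !koranyiE cpolar_mull. Qed.

Lemma koranyi_dil (r : R) (p q : H) : 0 <= r ->
  k (dil r p) (dil r q) = r * k p q.
Proof.
move=> r0; apply: eq_exp4; [exact: koranyi_ge0|exact: mulr_ge0 r0 (koranyi_ge0 _ _)|].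
by rewrite exprMn !koranyi_exp4 cpolar_dil cd_normsqZ -exprM.
Qed.

Lemma dil_o (r : R) : dil r o = o.
Proof.
apply: heis_eq => /=.
  by apply/matrixP => i j; rewrite !mxE scaler0.
by apply: imag_val_inj; rewrite imag_val0 /= scaler0.
Qed.

Lemma gauge_dil (r : R) (p : H) : 0 <= r -> g (dil r p) = r * g p.
Proof. by move=> /(koranyi_dil r p o); rewrite dil_o !koranyi_or. Qed.

Lemma koranyi_hinv (hO : K = Octonions -> n = 2%N) (p q : H) :
  p <> o -> q <> o -> k (hinv p) (hinv q) = k p q / (g p * g q).
Proof.
move=> p0 q0; apply: eq_exp4; first exact: koranyi_ge0.
  exact: divr_ge0 (koranyi_ge0 _ _) (mulr_ge0 (gauge_ge0 _) (gauge_ge0 _)).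
rewrite expr_div_n exprMn (koranyi_exp4 p q) (koranyi_exp4 (hinv p)) !gauge_exp4.
exact: normsq_cpolar_hinv.
Qed.

Lemma gauge_hinv (p : H) : p <> o -> g (hinv p) = (g p)^-1.
Proof.
move=> p0; apply: eq_exp4; [exact: gauge_ge0|by rewrite invr_ge0 gauge_ge0|].
by rewrite exprVn !gauge_exp4 hnorm4_hinv.
Qed.

Lemma cd_norm_sum (F : 'I_n.-1 -> carrier R K) :
  cd_norm (\sum_i F i : cayley_dickson R (doublings K)) <=
    \sum_i cd_norm (F i : cayley_dickson R (doublings K)).
Proof.
apply: (big_ind2 (fun (x : carrier R K) (y : R) => cd_norm x <= y)) => //.
- by rewrite cd_norm0.
- by move=> x a y b xa yb; apply: (le_trans (cd_normD _ _)); rewrite lerD.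
Qed.

(** Cauchy-Schwarz in the form given by the inequality between arithmetic and
    geometric mean, with a free weight [t]. *)
Lemma herm_le (t : R) (z w : V) : 0 < t ->
  2 * cd_norm (herm z w) <= t * vec_normsq z + vec_normsq w / t.
Proof.
move=> t0; rewrite -ler_pdivlMl //; apply: (le_trans (cd_norm_sum _)).
rewrite ler_pdivlMl // /vec_normsq !mulr_sumr mulr_suml -big_split /=.
apply: ler_sum => i _; rewrite (cd_normM doublings_le3) cd_norm_conj.
set a := cd_norm _; set b := cd_norm _.
rewrite -subr_ge0.
have -> : t * a ^+ 2 + b ^+ 2 / t - 2 * (a * b) = (t * a - b) ^+ 2 / t.
  by field; rewrite gt_eqF.
by rewrite divr_ge0 ?sqr_ge0 // ltW.
Qed.

Lemma vec_normsq_le_gauge (p : H) : vec_normsq p.1 <= g p ^+ 2.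
Proof.
rewrite -ler_sqr ?nnegrE ?vec_normsq_ge0 ?sqr_ge0 // -exprM gauge_exp4.
by rewrite /hnorm4 normsq_cgauge lerDl cd_normsq_ge0.
Qed.

Lemma koranyi_le_gauge (p q : H) : k p q <= g p + g q.
Proof.
have [->|/gauge_gt0 p0] := pselect (p = o); first by rewrite koranyi_ol gauge_o add0r.
have [->|/gauge_gt0 q0] := pselect (q = o); first by rewrite koranyi_or gauge_o addr0.
rewrite -(@ler_pXn2r _ 2) ?nnegrE ?koranyi_ge0 ?addr_ge0 ?gauge_ge0 //.
have -> : k p q ^+ 2 = cd_norm (cpolar p q).
  apply/eqP; rewrite -(@eqrXn2 _ 2) ?sqr_ge0 ?cd_norm_ge0 // -exprM.
  by rewrite koranyi_exp4 cd_norm_sqr.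
have : cd_norm (cpolar p q) <= g p ^+ 2 + g q ^+ 2 + 2 * cd_norm (herm p.1 q.1).
  rewrite !gauge_sqr -(cd_norm_conj (cgauge q)).
  apply: (le_trans (cd_normD _ _)); rewrite cd_normN cd_normZ normr_nat lerD2r.
  exact: cd_normD.
(* This weight balances the two terms of the bound at [g p * g q]. *)
have := herm_le (g q / g p) p.1 q.1 (divr_gt0 q0 p0).
have := vec_normsq_le_gauge p; have := vec_normsq_le_gauge q.
move: (g p) (g q) p0 q0 (cd_norm (cpolar p q)) (cd_norm (herm _ _)).
move: (vec_normsq p.1) (vec_normsq q.1) => x y a b a0 b0 u h yb xa ht ut.
have xa' : b / a * x <= b * a by rewrite -mulrA ler_pM2l // ler_pdivrMl // -expr2.
have yb' : y / (b / a) <= b * a.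
  rewrite ler_pdivrMr ?divr_gt0 //.
  have -> // : b * a * (b / a) = b ^+ 2 by field; rewrite gt_eqF.
by nra.
Qed.

Lemma koranyi_triangle (p q r : H) : k p r <= k p q + k q r.
Proof.
rewrite -(koranyi_mull (heis_inv q) p r) (koranyi_sym q r).
exact: koranyi_le_gauge.
Qed.

Lemma gaugeB (p q : H) : `|g p - g q| <= k p q.
Proof.
have h1 := koranyi_triangle o p q; have h2 := koranyi_triangle o q p.
move: h1 h2; rewrite !koranyi_ol (koranyi_sym q p) => h1 h2.
by rewrite ler_norml; lra.
Qed.

End Koranyi.


(** * Moebius transformations of the Koranyi metric *)

Section Moebius.
Context {R : realType} {K : division_algebra} {n : nat}.
Local Notation H := (heis R K n).
Local Notation o := (heis_origin R K n).
Local Notation k := (@koranyi R K n).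
Local Notation g := (@koranyi_gauge R K n).

(** A map that multiplies each factor [d p q] by [w p * w q] preserves cross
    ratios, because every point occurs once in the numerator and once in the
    denominator. Similarities and the inversion are both of this form. *)
Lemma cross_ratio_weight (d : H -> H -> R) (f : option H -> option H)
    (w : option H -> R) : (forall p, w p != 0) ->
  (forall p q, p != q ->
    cr_factor d (f p) (f q) = cr_factor d p q * (w p * w q)) ->
  forall p1 p2 p3 p4, uniq [:: p1; p2; p3; p4] ->
    cross_ratio d (f p1) (f p2) (f p3) (f p4) = cross_ratio d p1 p2 p3 p4.
Proof.
move=> w0 fw p1 p2 p3 p4; rewrite /= !inE !negb_or !andbT.
move=> /andP[/and3P[p12 p13 p14] /andP[/andP[p23 p24] p34]].
rewrite /cross_ratio !fw // 1?eq_sym // !invfM.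
move: (cr_factor d p4 p1)^-1 (cr_factor d p3 p2)^-1 => x y.
by field; rewrite !w0.
Qed.

Lemma boundary_continuousP (d : H -> H -> R) (f : option H -> option H) :
  (forall U : set (boundary d), boundary_open U ->
     boundary_open ((f : boundary d -> boundary d) @^-1` U)) ->
  continuous (f : boundary d -> boundary d).
Proof. by move=> fU; apply/continuousP => U; exact: fU. Qed.

Lemma similarity_continuous (T : H -> H) (l : R) : 0 < l ->
  (forall p q, k (T p) (T q) = l * k p q) ->
  continuous (omap T : boundary k -> boundary k).
Proof.
move=> l0 Tl; apply: boundary_continuousP => U [Uf Ui]; split=> [p|] /=.
  move=> /Uf[r r0 Ur]; exists (r / l); first by rewrite divr_gt0.
  by move=> q; rewrite ltr_pdivlMr // mulrC => pq; apply: Ur; rewrite Tl.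
move=> /Ui[r r0 Ur]; exists ((r + g (T o)) / l).
  by rewrite divr_gt0 // ltr_wpDr ?gauge_ge0.
move=> q; rewrite ltr_pdivrMr // mulrC -Tl => rq; apply: Ur.
rewrite -(ltrD2r (g (T o))); apply: (lt_le_trans rq).
by rewrite addrC -koranyi_or; exact: koranyi_triangle.
Qed.

Lemma moebius_similarity (T T' : H -> H) (l : R) : 0 < l ->
  cancel T T' -> cancel T' T ->
  (forall p q, k (T p) (T q) = l * k p q) -> moebius k (omap T).
Proof.
move=> l0 TK T'K Tl; split.
  split; first exact: (similarity_continuous _ _ l0 Tl).
  exists (omap T'); split.
  - by case=> //= p; rewrite TK.
  - by case=> //= p; rewrite T'K.
  - apply: (similarity_continuous _ l^-1); first by rewrite invr_gt0.
    by move=> p q; rewrite -{2}(T'K p) -{2}(T'K q) Tl mulKf // gt_eqF.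
(* A factor containing infinity is 1 and must remain so: the weight at infinity
   compensates the weight of the finite points. *)
pose w (p : option H) := if p is Some _ then Num.sqrt l else (Num.sqrt l)^-1.
have s0 : Num.sqrt l != 0 by rewrite gt_eqF // sqrtr_gt0.
apply: (cross_ratio_weight _ _ w) => [[p|]|[p|] [q|]] //= => [|_|_|_].
- by rewrite invr_eq0.
- by rewrite /cr_factor Tl -expr2 sqr_sqrtr ?ltW // mulrC.
- by rewrite /cr_factor divff // mulr1.
- by rewrite /cr_factor mulVf // mulr1.
Qed.

(** The inversion on the boundary: it exchanges the origin and infinity. *)
Definition einv (p : option H) : option H :=
  match p with
  | None => Some o
  | Some q => if pselect (q = o) then None else Some (hinv q)
  end.

Lemma einv_o : einv (Some o) = None.
Proof. by rewrite /=; case: pselect. Qed.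

Lemma einvE (p : H) : p <> o -> einv (Some p) = Some (hinv p).
Proof. by rewrite /=; case: pselect. Qed.

Lemma einvK : involutive einv.
Proof.
case=> [p|]; last exact: einv_o.
have [->|p0] := pselect (p = o); first by rewrite einv_o.
by rewrite einvE // einvE ?hinvK //; exact: hinv_neq0.
Qed.

Lemma einv_continuous (hO : K = Octonions -> n = 2%N) :
  continuous (einv : boundary k -> boundary k).
Proof.
apply: boundary_continuousP => U [Uf Ui]; split=> [p|].
  have [->|p0] := pselect (p = o).
    rewrite /preimage /mkset einv_o => /[dup] UN /Ui[r r0 Ur].
    exists r^-1 => [|q]; first by rewrite invr_gt0.
    rewrite koranyi_ol.
    have [->|q0] := pselect (q = o); first by rewrite einv_o.
    rewrite einvE // => qr; apply: Ur.
    by rewrite koranyi_ol gauge_hinv // -[r]invrK ltf_pV2 // posrE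
  ?invr_gt0 ?gauge_gt0.
  rewrite /preimage /mkset einvE // => /Uf[r r0 Ur].
  have gp := gauge_gt0 _ p0.
  exists (Num.min (g p / 2) (r * (g p ^+ 2 / 2))).
    by rewrite lt_min !(mulr_gt0, exprn_gt0).
  move=> q; rewrite lt_min => /andP[pq1 pq2].
  have gq : g p / 2 < g q.
    have := koranyi_triangle p q o; rewrite !koranyi_or => tr; lra.
  have q0 : q <> o by move=> q0; move: gq; rewrite q0 gauge_o; lra.
  rewrite einvE //; apply: Ur; rewrite koranyi_hinv //.
  rewrite ltr_pdivrMr ?mulr_gt0 ?gauge_gt0 //; apply: (lt_le_trans pq2).
  by rewrite ler_pM2l //; nra.
rewrite /preimage /mkset => /Uf[r r0 Ur]; exists r^-1; first by rewrite invr_gt0.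
move=> q; rewrite koranyi_ol => rq.
have q0 : q <> o.
  by move=> q0; move: rq; rewrite q0 gauge_o ltNge invr_ge0 ltW.
rewrite einvE //; apply: Ur.
by rewrite koranyi_ol gauge_hinv // -[r]invrK ltf_pV2 // posrE
  ?invr_gt0 ?gauge_gt0.
Qed.

Lemma moebius_einv (hO : K = Octonions -> n = 2%N) : moebius k einv.
Proof.
split.
  split; first exact: einv_continuous.
  by exists einv; split; [exact: einvK|exact: einvK|exact: einv_continuous].
pose w (p : option H) := if p is Some q then
  (if pselect (q = o) then 1 else (g q)^-1) else 1.
have w0 : w (Some o) = 1 by rewrite /w; case: pselect.
have wE p : p <> o -> w (Some p) = (g p)^-1 by rewrite /w; case: pselect.
have wN : w None = 1 by [].
have eN : einv None = Some o by [].
apply: (cross_ratio_weight _ _ w) => [[p|]|[p|] [q|]] //; rewrite ?oner_eq0 ?eN ?wN //.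
- have [->|p0] := pselect (p = o); first by rewrite w0 oner_eq0.
  by rewrite wE // invr_eq0 gt_eqF // gauge_gt0.
- move=> pq; have {}pq : p <> q by move=> E; rewrite E eqxx in pq.
  have [p0|p0] := pselect (p = o).
    have q0 : q <> o by rewrite -p0 => /esym.
    rewrite p0 einv_o einvE // w0 wE // /cr_factor koranyi_ol mul1r mulfV //.
    by rewrite gt_eqF // gauge_gt0.
  have [q0|q0] := pselect (q = o).
    rewrite q0 einv_o einvE // w0 wE // /cr_factor koranyi_or mulr1 mulfV //.
    by rewrite gt_eqF // gauge_gt0.
  by rewrite !einvE // !wE // /cr_factor koranyi_hinv // invfM.
- have [->|p0] := pselect (p = o); first by rewrite einv_o w0 /cr_factor !mulr1.
  by rewrite einvE // wE // /cr_factor koranyi_or gauge_hinv // mul1r mulr1.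
- have [->|q0] := pselect (q = o); first by rewrite einv_o w0 /cr_factor !mulr1.
  by rewrite einvE // wE // /cr_factor koranyi_ol gauge_hinv // !mul1r.
Qed.

Lemma moebius_translation (x : H) : moebius k (omap (heis_mul x)).
Proof.
apply: (@moebius_similarity _ (heis_mul (heis_inv x)) 1) => //.
- exact: heis_mulK.
- exact: heis_mulVK.
- by move=> p q; rewrite koranyi_mull mul1r.
Qed.

Lemma moebius_dil (r : R) : 0 < r -> moebius k (omap (dil r)).
Proof.
move=> r0; apply: (@moebius_similarity _ (dil r^-1) r) => //.
- by move=> p; rewrite dil_mul mulVf ?gt_eqF // dil1.
- by move=> p; rewrite dil_mul mulfV ?gt_eqF // dil1.
- by move=> p q; rewrite koranyi_dil // ltW.
Qed.

End Moebius.

(** * Real functions *)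

Section PowerLaw.
Import numFieldNormedType.Exports.
Context {R : realType}.

(** Cauchy's functional equation for monotone functions. *)
Lemma additive_linear (f : R -> R) : (forall s t, f (s + t) = f s + f t) ->
  (forall t, t <= 0 -> f t <= 0) -> forall t, f t = t * f 1.
Proof.
move=> fD f_le0 t.
have f0 : f 0 = 0 by apply: (addrI (f 0)); rewrite -fD !addr0.
have fN s : f (- s) = - f s by apply/eqP; rewrite -addr_eq0 -fD addNr f0.
have fn n s : f (n%:R * s) = n%:R * f s.
  elim: n => [|n IH]; first by rewrite !mul0r f0.
  by rewrite -addn1 natrD !mulrDl fD IH !mul1r.
have fz (m : int) : f m%:~R = m%:~R * f 1.
  case: m => n; first by rewrite -[n%:~R](mulr1 (n%:R : R)) fn mulr1.
  rewrite NegzE mulrNz fN mulNr; congr (- _).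
  by rewrite -[n.+1%:~R](mulr1 (n.+1%:R : R)) fn mulr1.
have f_homo s u : s <= u -> f s <= f u.
  by move=> su; rewrite -subr_le0 -fN -fD f_le0 // subr_le0.
have f1 : 0 <= f 1 by rewrite -f0 f_homo.
have bound n : n%:R * `|f t - t * f 1| <= f 1.
  rewrite -[n%:R]ger0_norm // -normrM mulrBr -fn mulrA.
  have /andP[h1 h2] := floor_itv (n%:R * t).
  have := f_homo _ _ h1; have := f_homo _ _ (ltW h2).
  have := ler_wpM2r f1 h1; have := ler_wpM2r f1 (ltW h2).
  by rewrite !fz intrD !mulrDl !mul1r ler_norml; lra.
apply/eqP; rewrite -subr_eq0; apply: contraT => ne.
have pos : 0 < `|f t - t * f 1| by rewrite normr_gt0.
have := bound (Num.truncn (f 1 / `|f t - t * f 1|)).+1.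
by rewrite -ler_pdivlMr // leNgt truncnS_gt.
Qed.

(** A multiplicative function on the positive reals that is below 1 near 0 is a
    power with positive exponent. *)
Lemma power_law (L : R -> R) : (forall r, 0 < r -> 0 < L r) ->
  (forall r s, 0 < r -> 0 < s -> L (r * s) = L r * L s) ->
  (exists2 eta, 0 < eta & forall r, 0 < r -> r < eta -> L r < 1) ->
  exists2 alpha, 0 < alpha & forall r, 0 < r -> L r = r `^ alpha.
Proof.
move=> L0 LM [eta eta0 Leta].
pose f t := ln (L (expR t)).
have fD s t : f (s + t) = f s + f t.
  by rewrite /f expRD LM ?expR_gt0 // lnM ?posrE ?L0 ?expR_gt0.
have f0 : f 0 = 0 by apply: (addrI (f 0)); rewrite -fD !addr0.
have fn n s : f (n%:R * s) = n%:R * f s.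
  elim: n => [|n IH]; first by rewrite !mul0r f0.
  by rewrite -addn1 natrD !mulrDl fD IH !mul1r.
have f_lt0 t : t < 0 -> f t < 0.
  (* A multiple of [t] lies below [ln eta], where [f] is known to be negative. *)
  move=> t0; pose n := (Num.truncn (`|ln eta| / - t)).+1.
  have n0 : 0 < n%:R :> R by rewrite ltr0n.
  rewrite -(pmulr_rlt0 _ n0) -fn; apply: ln_lt0.
  rewrite L0 ?expR_gt0 // Leta ?expR_gt0 // -[eta]lnK ?posrE // ltr_expR.
  have : `|ln eta| / - t < n%:R by exact: truncnS_gt.
  rewrite ltr_pdivrMr ?oppr_gt0 // mulrN ltrNr => h; apply: (lt_le_trans h).
  by rewrite lerNl -normrN ler_norm.
have f_le0 t : t <= 0 -> f t <= 0.
  by rewrite le_eqVlt => /orP[/eqP -> |/f_lt0 /ltW //]; rewrite f0.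
have flin := additive_linear _ fD f_le0.
exists (f 1).
  have := f_lt0 (-1); rewrite ltrN10 flin mulN1r oppr_lt0; exact.
move=> r r0; have := flin (ln r); rewrite /f lnK ?posrE // => E.
by rewrite -[L r]lnK ?posrE ?L0 // E /powR gt_eqF // mulrC.
Qed.

Lemma powR_continuous_at (alpha x eps : R) : 0 < x -> 0 < eps ->
  exists2 delta, 0 < delta &
    forall y, `|x - y| < delta -> `|x `^ alpha - y `^ alpha| < eps.
Proof.
move=> x0 eps0.
have cont : {for x, continuous (fun y : R => expR (alpha * ln y))}.
  apply: continuous_comp; last exact: continuous_expR.
  by apply: continuousM; [exact: cst_continuous|exact: continuous_ln].
have /cvgrPdist_lt /(_ _ eps0) /nbhs_ballP[r /= r0 near_x] := cont.
exists (Num.min r x); first by rewrite lt_min r0.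
move=> y; rewrite lt_min => /andP[xy /ltr_normlP[_ yx]].
have y0 : 0 < y by lra.
have := near_x y xy; by rewrite /powR !gt_eqF.
Qed.

(** The triangle inequality behind [dnorm_gauge_closed]: if [y = s * b], then
    [|x - y|] and [s * |a - b|] cannot both be below half of [|x - s * a|]. *)
Lemma far_apart (s x y a b : R) : 0 < s -> y = s * b ->
  `|x - y| < `|x - s * a| / 2 -> `|a - b| < `|x - s * a| / 2 / s -> False.
Proof.
move=> s0 -> xy ab; have : `|x - s * a| < `|x - s * a|; last by rewrite ltxx.
rewrite {1}(_ : x - s * a = (x - s * b) + s * (b - a)); last by ring.
apply: (le_lt_trans (ler_normD _ _)); rewrite [X in _ < X]splitr.
by rewrite ltrD // normrM (gtr0_norm s0) mulrC -ltr_pdivlMr // distrC.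
Qed.

Lemma tan_continuous_at (x eps : R) : cos x != 0 -> 0 < eps ->
  exists2 delta, 0 < delta &
    forall y, `|x - y| < delta -> `|tan x - tan y| < eps.
Proof.
move=> cx eps0.
have /cvgrPdist_lt /(_ _ eps0) /nbhs_ballP[r /= r0 near_x] := continuous_tan cx.
by exists r.
Qed.

End PowerLaw.

(** Angles of finite odd order are dense. They are approximated from below so
    that they stay in a quarter turn when the given angle does. *)
Lemma rational_angle {R : realType} (t delta : R) : 0 <= t -> 0 < delta ->
  exists s (i j : nat),
    [/\ 0 <= s, s <= t, t - s < delta & j.*2.+1%:R * s = i%:R * (pi *+ 2)].
Proof.
move=> t0 delta0; have pi2 : 0 < pi *+ 2 :> R by rewrite pmulrn_lgt0 ?pi_gt0.
pose j := Num.truncn ((pi *+ 2) / delta).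
have jlt : (pi *+ 2) / delta < j.*2.+1%:R.
  apply: (lt_le_trans (truncnS_gt _)); rewrite ler_nat -addnn ltnS.
  exact: leq_addr.
have j0 : 0 < j.*2.+1%:R :> R by rewrite ltr0n.
pose x := j.*2.+1%:R * t / (pi *+ 2).
have x0 : 0 <= x by rewrite divr_ge0 ?mulr_ge0 // ltW.
have /andP[h1 h2] := truncn_itv x0.
pose i := Num.truncn x.
exists (i%:R * (pi *+ 2) / j.*2.+1%:R), i, j; split.
- by rewrite divr_ge0 ?mulr_ge0 // ltW.
- rewrite ler_pdivrMr // -ler_pdivlMr // [t * _]mulrC; exact: h1.
- move: h2; rewrite /x -/x -/i ltr_pdivrMr // -[i.+1%:R]natr1 mulrDl mul1r => h2.
  rewrite -(ltr_pM2l j0) mulrBr.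
  have -> : j.*2.+1%:R * (i%:R * (pi *+ 2) / j.*2.+1%:R) = i%:R * (pi *+ 2) :> R.
    by rewrite mulrC divfK // gt_eqF.
  by rewrite ltrBlDl; apply: (lt_trans h2); rewrite ltrD2l -ltr_pdivrMr.
- by rewrite mulrC divfK // gt_eqF.
Qed.

Lemma cos_turns {R : realType} (i : nat) : cos (i%:R * (pi *+ 2)) = 1 :> R.
Proof.
elim: i => [|i IH]; first by rewrite mul0r cos0.
by rewrite -natr1 mulrDl mul1r cosD2pi.
Qed.

Lemma sin_turns {R : realType} (i : nat) : sin (i%:R * (pi *+ 2)) = 0 :> R.
Proof.
elim: i => [|i IH]; first by rewrite mul0r sin0.
by rewrite -natr1 mulrDl mul1r sinD2pi.
Qed.

(** * Points in polar form *)

Section Rotation.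
Context {R : realType} {K : division_algebra} {n : nat}.
Context (nu : imag R K) (nu1 : cd_normsq (imag_val nu) = 1).
Local Notation V := ('rV[carrier R K]_(n.-1)).
Local Notation H := (heis R K n).
Local Notation o := (heis_origin R K n).
Local Notation k := (@koranyi R K n).
Local Notation g := (@koranyi_gauge R K n).
Local Notation one := (cd_one (doublings K) : carrier R K).

(** The unit [cos t + sin t nu] of the complex line spanned by 1 and [nu]. *)
Definition phase (t : R) : carrier R K := cos t *: one + sin t *: imag_val nu.

Lemma normsq_phase t : cd_normsq (phase t) = 1.
Proof.
rewrite (cd_normsq_real_imag _ _ (imaginaryZ (sin t) nu)) cd_normsqZ nu1 mulr1.
exact: cos2Dsin2.
Qed.

Lemma vmulr_one (z : V) : vmulr z one = z.
Proof. by apply/matrixP => i j; rewrite !mxE cd_mul_one. Qed.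

(** Right multiplications by phases compose by adding angles, even over the
    octonions, since only [(x nu) nu = - x] is used. *)
Lemma vmulr_phaseD (z : V) s t :
  vmulr (vmulr z (phase s)) (phase t) = vmulr z (phase (s + t)).
Proof.
apply/matrixP => i j; rewrite !mxE /phase cosD sinD.
have E (x : carrier R K) : cd_mul (cd_mul x nu) nu = - x.
  rewrite -[imag_val nu in X in cd_mul _ X]opprK -imag_conj cd_mulNr.
  by rewrite (cd_mul_conjr doublings_le3) nu1 scale1r.
rewrite !(cd_mulDr, cd_mulDl, cd_mulZr, cd_mulZl, cd_mul_one) E.
apply: cd_dot_ext => w; rewrite !(cd_dotDr, cd_dotZr, cd_dotNr).
by ring.
Qed.

Lemma vmulr_phase_turns (z : V) i : vmulr z (phase (i%:R * (pi *+ 2))) = z.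
Proof. by rewrite /phase cos_turns sin_turns scale1r scale0r addr0 vmulr_one. Qed.

Lemma phase0 : phase 0 = one.
Proof. by rewrite /phase cos0 sin0 scale1r scale0r addr0. Qed.

(** For [z <> 0] and [cos t > 0], the point with horizontal part [z * phase s]
    for which [cgauge] is a positive multiple of [phase t]. *)
Definition hpoint (z : V) (s t : R) : H :=
  (vmulr z (phase s), iscale (vec_normsq z * tan t) nu).

Lemma cgauge_hpoint (z : V) s t : cos t != 0 ->
  cgauge (hpoint z s t) = (vec_normsq z / cos t) *: phase t.
Proof.
move=> ct; rewrite /cgauge vec_normsq_vmulr normsq_phase mulr1 /phase.
rewrite scalerDr !scalerA divfK // /tan.
by congr (_ + _ *: _); rewrite mulrA mulrAC.
Qed.

Lemma gauge_hpoint_sqr (z : V) s t : 0 < cos t ->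
  g (hpoint z s t) ^+ 2 = vec_normsq z / cos t.
Proof.
move=> ct; rewrite gauge_sqr cgauge_hpoint ?gt_eqF // cd_normZ.
rewrite /cd_norm normsq_phase sqrtr1 mulr1 ger0_norm //.
by rewrite divr_ge0 ?vec_normsq_ge0 // ltW.
Qed.

Lemma gauge_hpoint (z : V) s t : 0 < cos t ->
  g (hpoint z s t) = g (hpoint z 0 t).
Proof.
move=> ct; have x0 := gauge_ge0 (hpoint z s t).
have y0 := gauge_ge0 (hpoint z 0 t).
have := gauge_hpoint_sqr z 0 t ct; rewrite -(gauge_hpoint_sqr z s t ct).
move: (g _) (g _) x0 y0 => x y x0 y0 /eqP.
by rewrite eqrXn2 // => /eqP.
Qed.

Lemma hpoint_neq0 (z : V) s t : z <> 0 -> 0 < cos t -> hpoint z s t <> o.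
Proof.
move=> z0 ct E; have := gauge_hpoint_sqr z s t ct.
rewrite E gauge_o expr0n /= => /esym /eqP.
rewrite mulf_eq0 invr_eq0 (gt_eqF ct) orbF => /eqP /vec_normsq_eq0.
exact: z0.
Qed.

Lemma koranyi_vertical (z : V) (v w : imag R K) :
  k (z, v) (z, w) ^+ 4 = cd_normsq (imag_val v - imag_val w).
Proof.
rewrite koranyi_exp4 /cpolar /cgauge cd_conjD cd_conjZ cd_conj_one imag_conj /=.
rewrite herm_self; congr cd_normsq; apply: cd_dot_ext => x.
rewrite !(cd_dotDr, cd_dotZr, cd_dotNr) /=; by ring.
Qed.

Lemma koranyi_hpoint (z : V) s t t' : k (hpoint z s t) (hpoint z s t') ^+ 2 =
  vec_normsq z * `|tan t - tan t'|.
Proof.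
apply/eqP; rewrite -(@eqrXn2 _ 2) ?sqr_ge0 ?mulr_ge0 ?vec_normsq_ge0 //.
rewrite -exprM koranyi_vertical !imag_iscale -scalerBl cd_normsqZ nu1 mulr1.
by rewrite -mulrBr !exprMn real_normK ?num_real.
Qed.

(** Points whose angle has finite odd order are dense on a half-line of points
    with fixed horizontal part. *)
Lemma hpoint_dense (z : V) (t eta : R) :
  z <> 0 -> 0 <= t -> t < pi / 2 -> 0 < eta ->
  exists s (i j : nat), [/\ 0 < cos s, j.*2.+1%:R * s = i%:R * (pi *+ 2) &
    k (hpoint z 0 t) (hpoint z 0 s) < eta].
Proof.
move=> z0 t0 tpi eta0; have zp := vec_normsq_gt0 z z0.
have pihalf : - (pi / 2) < 0 :> R by rewrite oppr_lt0 divr_gt0 ?pi_gt0.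
have ct : cos t != 0.
  by rewrite gt_eqF // cos_gt0_pihalf // tpi (lt_le_trans pihalf).
have e1 : 0 < eta ^+ 2 / vec_normsq z by rewrite divr_gt0 // exprn_gt0.
have [r r0 near_t] := tan_continuous_at _ _ ct e1.
have [s [i [j [s0 st tsr js]]]] := rational_angle _ _ t0 r0.
exists s, i, j; split=> //.
  by rewrite cos_gt0_pihalf // (le_lt_trans st tpi) (lt_le_trans pihalf).
have ts : `|tan t - tan s| < eta ^+ 2 / vec_normsq z.
  by apply: near_t; rewrite ger0_norm // subr_ge0.
have kE := koranyi_hpoint z 0 t s.
have k0 := koranyi_ge0 (hpoint z 0 t) (hpoint z 0 s).
have : k (hpoint z 0 t) (hpoint z 0 s) ^+ 2 < eta ^+ 2.
  by rewrite kE mulrC -ltr_pdivlMr.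
move: (k _ _) k0 => x x0.
by rewrite ltr_pXn2r ?nnegrE // ltW.
Qed.

End Rotation.

(** Every point off the horizontal and the vertical has a polar form. *)
Lemma polar_hpoint {R : realType} {K : division_algebra} {n : nat}
    (p : heis R K n) : p.1 <> 0 -> p.2 <> 0 ->
  exists nu t, [/\ cd_normsq (imag_val nu) = 1, 0 <= t, t < pi / 2 &
    p = hpoint nu p.1 0 t].
Proof.
move=> z0 v0; have zp := vec_normsq_gt0 _ z0.
have vp : 0 < cd_norm (imag_val p.2).
  rewrite sqrtr_gt0 lt_neqAle cd_normsq_ge0 andbT eq_sym.
  apply/negP => /eqP /cd_normsq_eq0 v0'; apply: v0.
  by apply: imag_val_inj; rewrite v0' imag_val0.
exists (iscale (cd_norm (imag_val p.2))^-1 p.2).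
exists (atan (cd_norm (imag_val p.2) / vec_normsq p.1)); split.
- rewrite imag_iscale cd_normsqZ -cd_norm_sqr -exprMn mulVf ?expr1n //.
  by rewrite gt_eqF.
- by rewrite -atan0 le_atan // divr_ge0 // ltW.
- exact: atan_ltpi2.
apply: heis_eq; rewrite /hpoint /=.
  by rewrite phase0 vmulr_one.
rewrite atanK iscaleA -[LHS]iscale1; congr iscale.
by field; rewrite !gt_eqF.
Qed.

(** * Rigidity *)

Section Rigidity.
Context {R : realType} {K : division_algebra} {n : nat}.
Context (hn : (2 <= n)%N) (hO : K = Octonions -> n = 2%N).
Local Notation A := (carrier R K).
Local Notation V := ('rV[carrier R K]_(n.-1)).
Local Notation H := (heis R K n).
Local Notation o := (heis_origin R K n).
Local Notation k := (@koranyi R K n).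
Local Notation g := (@koranyi_gauge R K n).
Context (d : H -> H -> R) (d_metric : is_metric d) (d_top : same_topology d k).
Context (d_moebius : moebius d = moebius k).

(** A horizontal point distinct from the origin, used as a unit of length. *)
Definition heis_unit : H := (const_mx (cd_one (doublings K) : carrier R K), 0).
Local Notation e := heis_unit.

Lemma heis_unit_neq0 : e <> o.
Proof.
have n1 : (0 < n.-1)%N by case: n hn => [|[]].
move=> /(congr1 fst) /= /matrixP /(_ 0 (Ordinal n1)); rewrite !mxE => one0.
have := cd_normsq_one (R:=R) (doublings K).
rewrite [cd_one _]one0 cd_dotE cd_dot0l => /eqP.
by rewrite eq_sym oner_eq0.
Qed.

Lemma d_ge0 p q : 0 <= d p q. Proof. by case: d_metric. Qed.
Lemma d_sym p q : d p q = d q p. Proof. by case: d_metric. Qed.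
Lemma d_triangle p q r : d p r <= d p q + d q r. Proof. by case: d_metric. Qed.
Lemma d_xx p : d p p = 0. Proof. by case: d_metric => _ h _ _; apply/h. Qed.
Lemma d_eq0 p q : d p q = 0 -> p = q.
Proof. by case: d_metric => _ h _ _ /h. Qed.

Lemma d_gt0 p q : p <> q -> 0 < d p q.
Proof.
move=> pq; rewrite lt_neqAle d_ge0 andbT eq_sym.
by apply: contra_notN pq => /eqP /d_eq0.
Qed.

(** A Moebius transformation fixing infinity preserves ratios of distances to a
    common point: this is invariance of cross-ratios with one point at
    infinity. *)
Lemma moebius_d_ratio (T : H -> H) (p q r : H) :
  injective T -> moebius k (omap T) -> p <> q -> r <> q ->
  d (T r) (T q) * d p q = d r q * d (T p) (T q).
Proof.
move=> Tinj Tk pq rq.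
have [-> |rp] := pselect (r = p); first by rewrite mulrC.
move: Tk; rewrite -d_moebius => -[_ /(_ None (Some q) (Some p) (Some r))].
have neq (x y : H) : x <> y -> (Some x == Some y) = false.
  by move=> xy; apply/eqP => -[].
rewrite /= !inE !neq //; try by move/esym.
rewrite /cross_ratio /cr_factor /= !divr1 !mul1r => /(_ isT) E.
have d0 x y : x <> y -> d x y != 0.
  by move=> /d_gt0; rewrite lt_neqAle eq_sym => /andP[].
have d1 x y : x <> y -> d (T x) (T y) != 0.
  by move=> xy; apply: d0 => /Tinj.
move/eqP: E; by rewrite eqr_div ?d1 ?d0 // => /eqP.
Qed.

(** The [d]-balls are neighbourhoods for the Koranyi metric. *)
Lemma d_continuous p (eps : R) : 0 < eps ->
  exists2 eta, 0 < eta & forall q, k p q < eta -> d p q < eps.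
Proof.
move=> eps0.
pose U : set (option H) := [set x | if x is Some q then d p q < eps else False].
have : open (U : set (boundary d)).
  split=> // q Uq; exists (eps - d p q); first by rewrite subr_gt0.
  by move=> r; rewrite ltrBrDl; apply: le_lt_trans; exact: d_triangle.
move=> /d_top[/(_ p)]; rewrite /U /= d_xx => /(_ eps0)[r r0 Ur] _.
by exists r.
Qed.

(** The common ratio is found by moving one point at a time, from the pair
    [(e, o)] to [(p, o)] and then to [(p, q)]. *)
Lemma d_similarity (T : H -> H) : injective T -> moebius k (omap T) ->
  exists2 l, 0 < l & forall p q, d (T p) (T q) = l * d p q.
Proof.
move=> Tinj Tk; have eo := heis_unit_neq0.
have deo := d_gt0 _ _ eo.
exists (d (T e) (T o) / d e o); first by rewrite divr_gt0 // d_gt0 // => /Tinj.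
have ratio := fun p q r => moebius_d_ratio T p q r Tinj Tk.
have To p : d (T p) (T o) = d (T e) (T o) / d e o * d p o.
  have [->|po] := pselect (p = o); first by rewrite !d_xx mulr0.
  by rewrite mulrAC (ratio p o e) // mulrAC divff ?mul1r // gt_eqF.
move=> p q; have [->|pq] := pselect (p = q); first by rewrite !d_xx mulr0.
have [->|qo] := pselect (q = o); first exact: To.
have doq : d o q != 0 by rewrite gt_eqF // d_gt0 // => /esym.
apply: (mulfI doq); rewrite -(ratio p q o) //; last exact/nesym.
rewrite (d_sym (T o)) To (d_sym o q).
by ring.
Qed.

Lemma d_mull_ratio x :
  exists2 l, 0 < l & forall p q, d (heis_mul x p) (heis_mul x q) = l * d p q.
Proof.
apply: d_similarity; last exact: moebius_translation.
exact: can_inj (heis_mulK x).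
Qed.

Lemma d_dil_ratio (r : R) : 0 < r ->
  exists2 l, 0 < l & forall p q, d (dil r p) (dil r q) = l * d p q.
Proof.
by move=> r0; apply: d_similarity; [exact: dil_inj|exact: moebius_dil].
Qed.

Lemma iter_mull_ratio (x : H) (l : R) m :
  (forall p q, d (heis_mul x p) (heis_mul x q) = l * d p q) ->
  forall p q, d (iter m (heis_mul x) p) (iter m (heis_mul x) q) = l ^+ m * d p q.
Proof.
move=> xl p q; elim: m => [|m IH]; first by rewrite mul1r.
by rewrite !iterS xl IH exprS mulrA.
Qed.

(** If the dilation of ratio 2 sends [x] to [x^m] with [m > 1], then conjugating
    the left translation by [x] with that dilation shows that its ratio [l]
    satisfies [l = l^m], hence is 1. *)
Lemma d_mull_pow (x : H) m : (1 < m)%N ->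
  (forall p, heis_mul (dil 2 x) p = iter m (heis_mul x) p) ->
  forall p q, d (heis_mul x p) (heis_mul x q) = d p q.
Proof.
move=> m1 xm; have [l l0 xl] := d_mull_ratio x.
have [c c0 dc] := d_dil_ratio 2 (ltr0n _ 2).
have deo := d_gt0 _ _ heis_unit_neq0.
have : c * (l * d e o) = l ^+ m * (c * d e o).
  by rewrite -xl -dc !dil_heis_mul !xm (iter_mull_ratio _ _ m xl) dc.
have -> : l ^+ m * (c * d e o) = c * (l ^+ m * d e o) by ring.
move=> /(mulfI (lt0r_neq0 c0)) /(mulIf (lt0r_neq0 deo)) lm.
have l1 : l = 1.
  case: m m1 lm {xm} => // m m1; rewrite exprS -{1}[l]mulr1.
  move=> /(mulfI (lt0r_neq0 l0)) /esym /eqP.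
  by rewrite pexpr_eq1 ?ltW // => /eqP.
by move=> p q; rewrite xl l1 mul1r.
Qed.

(** Left translations are isometries of [d]: the lemma above applies with [m = 2]
    to horizontal points and with [m = 4] to vertical ones, and these generate. *)
Lemma d_mull x p q : d (heis_mul x p) (heis_mul x q) = d p q.
Proof.
have zD (z : V) : heis_mul (z, 0) (z, 0) = dil 2 (z, 0).
  apply: heis_eq => /=.
    by rewrite -[z in RHS]vscale1 vscaleA mulr1 -[2]/(1 + 1) vscaleDl vscale1.
  apply: imag_val_inj; rewrite omega_self mul0rn !addr0 imag_iscale imag_val0.
  by rewrite scaler0.
have vD (u v : imag R K) : heis_mul (0, u) (0, v) = (0, u + v) :> H.
  by rewrite /heis_mul /= omega_self mul0rn !addr0.
have -> : x = heis_mul (x.1, 0) (0, x.2).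
  by case: x => z v; rewrite /heis_mul /= omega0r mul0rn !addr0 add0r.
rewrite -!heis_mulA (@d_mull_pow (x.1, 0) 2) //; last first.
  by move=> r /=; rewrite heis_mulA zD.
apply: (@d_mull_pow (0, x.2) 4) => // r.
rewrite /= !heis_mulA !vD; congr heis_mul.
apply: heis_eq => /=; first by apply/matrixP => i j; rewrite !mxE scaler0.
apply: imag_val_inj; rewrite imag_iscale !imag_valD.
apply: cd_dot_ext => w; rewrite !(cd_dotDr, cd_dotZr).
by ring.
Qed.

(** The [d]-distance to the origin, which determines [d] by left invariance. *)
Definition dnorm (p : H) := d o p.

Lemma d_dnorm p q : d p q = dnorm (heis_mul (heis_inv q) p).
Proof. by rewrite -(d_mull (heis_inv q)) heis_mulVr d_sym. Qed.

Lemma dnorm_inv p : dnorm (heis_inv p) = dnorm p.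
Proof. by rewrite /dnorm -(d_mull p) heis_mulrV heis_mul0r d_sym. Qed.

Lemma dnorm_ge0 p : 0 <= dnorm p. Proof. exact: d_ge0. Qed.

Lemma dnorm_gt0 p : p <> o -> 0 < dnorm p.
Proof. by move=> po; apply: d_gt0; exact/nesym. Qed.

(** The ratio of the dilation of factor [r] is multiplicative in [r], and small
    with [r] because [d] is continuous; hence it is a power of [r]. *)
Lemma dnorm_dil_powR : exists2 alpha, 0 < alpha &
  forall r p, 0 < r -> dnorm (dil r p) = r `^ alpha * dnorm p.
Proof.
have e0 := dnorm_gt0 _ heis_unit_neq0.
pose L r := dnorm (dil r e) / dnorm e.
have LE r p : 0 < r -> dnorm (dil r p) = L r * dnorm p.
  move=> /d_dil_ratio[l l0 dl].
  have E q : dnorm (dil r q) = l * dnorm q by rewrite /dnorm -dl dil_o.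
  by rewrite /L !E mulfK // gt_eqF.
have L0 r : 0 < r -> 0 < L r.
  move=> r0; rewrite divr_gt0 // dnorm_gt0 // => re.
  by apply: heis_unit_neq0; apply: (dil_inj _ r0); rewrite dil_o.
have LM r s : 0 < r -> 0 < s -> L (r * s) = L r * L s.
  by move=> r0 s0; rewrite {1}/L -dil_mul LE // mulrA.
have [eta eta0 small] := d_continuous o _ e0.
have [] := power_law _ L0 LM.
  exists (eta / g e).
    by rewrite divr_gt0 // gauge_gt0 //; exact: heis_unit_neq0.
  move=> r r0 re; rewrite /L ltr_pdivrMr // mul1r; apply: small.
  rewrite koranyi_ol gauge_dil ?ltW // -ltr_pdivlMr //.
  exact: gauge_gt0 heis_unit_neq0.
by move=> alpha alpha0 Lal; exists alpha => // r p r0; rewrite LE // Lal.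
Qed.

(** Invariance under the inversion of the cross-ratios containing the origin and
    infinity. *)
Lemma dnorm_hinv : exists2 C, 0 < C & forall p, p <> o ->
  dnorm p * dnorm (hinv p) = C.
Proof.
have eo := heis_unit_neq0.
have Ie : hinv e <> o by exact: hinv_neq0.
exists (dnorm e * dnorm (hinv e)); first by rewrite mulr_gt0 // dnorm_gt0.
move=> p po; have [->//|pe] := pselect (p = e).
have Ip : hinv p <> o by exact: hinv_neq0.
have Ik : moebius k einv by exact: moebius_einv.
move: Ik; rewrite -d_moebius => -[_].
move=> /(_ (Some o) None (Some p) (Some e)).
have neq (x y : H) : x <> y -> (Some x == Some y) = false.
  by move=> xy; apply/eqP => -[].
rewrite einv_o !einvE // [uniq _]/= !inE !neq //; try exact/nesym.
rewrite /cross_ratio /cr_factor /= !divr1 !mul1r => /(_ isT).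
rewrite [d e o]d_sym [d p o]d_sym [d (hinv e) o]d_sym [d (hinv p) o]d_sym.
rewrite -!/(dnorm _) => E.
have h x : x <> o -> dnorm x != 0 by move=> xo; rewrite gt_eqF // dnorm_gt0.
have -> : dnorm p = dnorm e * (dnorm (hinv e) / dnorm (hinv p)).
  by rewrite E mulrA divff ?mul1r // h.
by field; rewrite h.
Qed.

(** The dilation of factor 2 squares a horizontal point, so the triangle
    inequality bounds [2 ^ alpha] by 2. *)
Lemma exponent_le1 alpha :
  (forall r p, 0 < r -> dnorm (dil r p) = r `^ alpha * dnorm p) -> alpha <= 1.
Proof.
move=> dnormZ.
have e0 := dnorm_gt0 _ heis_unit_neq0.
have ee : dil 2 e = heis_mul e e.
  apply: heis_eq => /=.
    by rewrite -[2]/(1 + 1) vscaleDl vscale1.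
  apply: imag_val_inj.
  by rewrite omega_self mul0rn !addr0 imag_iscale imag_val0 scaler0.
have : dnorm (dil 2 e) <= dnorm e + dnorm e.
  have := d_triangle o e (heis_mul e e).
  by have := d_mull e o e; rewrite heis_mul0r ee /dnorm => ->.
rewrite dnormZ // -[X in _ <= X]mulr2n -[X in _ <= X]mulr_natl ler_pM2r //.
have l2 : 0 < ln 2 :> R by rewrite ln_gt0 // ltr1n.
move=> h; have : ln (2 `^ alpha) <= ln 2 :> R by rewrite ler_ln ?posrE ?powR_gt0.
by rewrite ln_powR -[X in _ <= X]mul1r ler_pM2r.
Qed.

(** The group inverse of the inversion of [(z, v)] is a dilation of [(z u, v)],
    where [u] is [cgauge] divided by its norm. The functional equation of
    [dnorm] under inversion therefore relates [(z, v)] and [(z u, v)]. *)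
Lemma dnorm_twist alpha C :
  (forall r p, 0 < r -> dnorm (dil r p) = r `^ alpha * dnorm p) ->
  (forall p, p <> o -> dnorm p * dnorm (hinv p) = C) ->
  forall p, p <> o ->
  dnorm p * dnorm (vmulr p.1 ((g p ^+ 2)^-1 *: cgauge p), p.2) =
  C * (g p `^ alpha) ^+ 2.
Proof.
move=> dnormZ dnormI p po; have gp := gauge_gt0 _ po.
have g2 : 0 < (g p ^+ 2)^-1 by rewrite invr_gt0 exprn_gt0.
rewrite -(dnormI p po) -(dnorm_inv (hinv p)).
have -> : heis_inv (hinv p) =
    dil (g p ^+ 2)^-1 (vmulr p.1 ((g p ^+ 2)^-1 *: cgauge p), p.2).
  apply: heis_eq.
    rewrite [RHS]/= vmulrZ vscaleA.
    have -> : (heis_inv (hinv p)).1 = - (hinv p).1 by [].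
    have -> : (hinv p).1 = vmulr p.1 (- (hnorm4 p)^-1 *: cgauge p) by [].
    rewrite vmulrZ -gauge_exp4; apply/matrixP => i j.
    rewrite !mxE -scaleNr opprK.
    by congr (_ *: _); field; rewrite gt_eqF.
  apply: imag_val_inj; rewrite imag_heis_inv !imag_iscale -scaleNr opprK.
  rewrite -gauge_exp4.
  by congr (_ *: _); field; rewrite gt_eqF.
rewrite dnormZ // -[RHS]mulrA; congr (_ * _).
rewrite mulrAC -[LHS]mul1r; congr (_ * _).
rewrite [(_ `^ _) ^+ 2]expr2 -powRM ?gauge_ge0 //.
rewrite -powRM ?mulr_ge0 ?gauge_ge0 ?ltW //.
by rewrite -expr2 mulVf ?powR1 // gt_eqF // exprn_gt0.
Qed.

Section Exponent.
Context (alpha C : R) (alpha0 : 0 < alpha) (C0 : 0 < C).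
Context (dnormZ : forall r p, 0 < r -> dnorm (dil r p) = r `^ alpha * dnorm p).
Context (dnormI : forall p, p <> o -> dnorm p * dnorm (hinv p) = C).

Lemma dnorm_sqr_eq (p : H) :
  dnorm p * dnorm p = C * (g p `^ alpha) ^+ 2 ->
  dnorm p = Num.sqrt C * g p `^ alpha.
Proof.
move=> E; apply/eqP; rewrite -(@eqrXn2 _ 2) ?dnorm_ge0 //; last first.
  by rewrite mulr_ge0 ?sqrtr_ge0 ?powR_ge0.
by rewrite exprMn sqr_sqrtr ?ltW // expr2 E.
Qed.

(** If [u = phase t] has odd order, the twist returns to its starting point after
    an odd number of steps. Two consecutive values of [dnorm] have a constant
    product, so that they are all equal. *)
Lemma dnorm_hpoint (nu : imag R K) (z : V) (t : R) (i j : nat) :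
  cd_normsq (imag_val nu) = 1 -> z <> 0 -> 0 < cos t ->
  j.*2.+1%:R * t = i%:R * (pi *+ 2) ->
  dnorm (hpoint nu z 0 t) = Num.sqrt C * g (hpoint nu z 0 t) `^ alpha.
Proof.
move=> nu1 z0 ct jt; apply: dnorm_sqr_eq.
set G := (X in _ = X).
have hp0 s : hpoint nu z s t <> o by exact: hpoint_neq0.
have step s : dnorm (hpoint nu z s t) * dnorm (hpoint nu z (s + t) t) = G.
  rewrite /G -(gauge_hpoint _ nu1 z s _ ct).
  rewrite -(dnorm_twist _ _ dnormZ dnormI _ (hp0 s)).
  rewrite (gauge_hpoint_sqr _ nu1) // (cgauge_hpoint _ nu1) ?gt_eqF //.
  rewrite scalerA mulVf ?scale1r; last first.
    by rewrite gt_eqF // divr_gt0 // vec_normsq_gt0.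
  by rewrite (vmulr_phaseD _ nu1).
have even m : dnorm (hpoint nu z (m.*2%:R * t) t) = dnorm (hpoint nu z 0 t).
  elim: m => [|m IH]; first by rewrite mul0r.
  have -> : m.+1.*2%:R * t = m.*2%:R * t + t + t.
    by rewrite doubleS -addn2 natrD; ring.
  rewrite -IH.
  have h := step (m.*2%:R * t); rewrite -(step (m.*2%:R * t + t)) mulrC in h.
  by apply/esym; apply: mulfI h; rewrite gt_eqF // dnorm_gt0.
rewrite -[G](step (j.*2%:R * t)) even; congr (_ * dnorm _).
have -> : j.*2%:R * t + t = i%:R * (pi *+ 2).
  by rewrite -jt -[j.*2.+1%:R]natr1; ring.
rewrite /hpoint vmulr_phase_turns.
by rewrite phase0 vmulr_one.
Qed.

(** On horizontal and on vertical points the twist is the identity. *)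
Lemma dnorm_straight (p : H) : p <> o -> p.1 = 0 \/ p.2 = 0 ->
  dnorm p = Num.sqrt C * g p `^ alpha.
Proof.
move=> po zv; apply: dnorm_sqr_eq; rewrite -(dnorm_twist _ _ dnormZ dnormI) //.
congr (_ * dnorm _); apply: heis_eq => //=.
case: zv => [->|v0]; first by apply/matrixP => i j; rewrite !mxE cd_mul0l.
have E : cgauge p = vec_normsq p.1 *: (cd_one (doublings K) : A).
  by rewrite /cgauge v0 imag_val0 addr0.
rewrite gauge_sqr E cd_normZ /cd_norm cd_normsq_one sqrtr1 mulr1.
rewrite ger0_norm ?vec_normsq_ge0 // scalerA mulVf ?scale1r ?vmulr_one //.
by rewrite gt_eqF // vec_normsq_gt0 // => z0; apply: po; exact: heis_eq.
Qed.

Lemma dnormB (p q : H) : `|dnorm p - dnorm q| <= d p q.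
Proof.
have h1 := d_triangle o p q; have h2 := d_triangle o q p.
by rewrite ler_norml (d_sym q) in h2 *; rewrite /dnorm; lra.
Qed.

(** The formula for [dnorm] passes to limits in the Koranyi metric. *)
Lemma dnorm_gauge_closed (p : H) : p <> o ->
  (forall eta, 0 < eta ->
    exists2 q, k p q < eta & dnorm q = Num.sqrt C * g q `^ alpha) ->
  dnorm p = Num.sqrt C * g p `^ alpha.
Proof.
move=> po approx; have gp := gauge_gt0 _ po.
have [//|ne] := eqVneq (dnorm p) (Num.sqrt C * g p `^ alpha).
pose e0 := `|dnorm p - Num.sqrt C * g p `^ alpha|.
have e0p : 0 < e0 / 2 by rewrite divr_gt0 // normr_gt0 subr_eq0.
have sC : 0 < Num.sqrt C by rewrite sqrtr_gt0.
have [eta1 eta10 near1] := d_continuous p _ e0p.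
have [eta2 eta20 near2] := powR_continuous_at alpha _ _ gp (divr_gt0 e0p sC).
have [|q] := approx (Num.min eta1 eta2); first by rewrite lt_min eta10.
rewrite lt_min => /andP[kpq1 kpq2] qE.
have n1 := le_lt_trans (dnormB p q) (near1 q kpq1).
have n2 := near2 _ (le_lt_trans (gaugeB p q) kpq2).
by case: (far_apart _ _ _ _ _ sC qE n1 n2).
Qed.

Lemma dnorm_gauge (p : H) : dnorm p = Num.sqrt C * g p `^ alpha.
Proof.
have [->|po] := pselect (p = o).
  by rewrite /dnorm d_xx gauge_o powR0 ?mulr0 // gt_eqF.
have [z0|z0] := pselect (p.1 = 0); first by apply: dnorm_straight => //; left.
have [v0|v0] := pselect (p.2 = 0); first by apply: dnorm_straight => //; right.
have [nu [t [nu1 t0 tpi pE]]] := polar_hpoint p z0 v0.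
apply: dnorm_gauge_closed => // eta eta0.
have [s [i [j [cs js kts]]]] := hpoint_dense nu nu1 _ _ _ z0 t0 tpi eta0.
exists (hpoint nu p.1 0 s); last exact: dnorm_hpoint js.
by rewrite [X in k X _]pE.
Qed.

End Exponent.

Lemma metric_eq_koranyi_powR : exists alpha beta : R,
  [/\ 0 < alpha, alpha <= 1, 0 < beta &
    forall p q : H, d p q = beta * k p q `^ alpha].
Proof.
have [alpha alpha0 dnormZ] := dnorm_dil_powR.
have [C C0 dnormI] := dnorm_hinv.
exists alpha, (Num.sqrt C); split=> //.
- exact: exponent_le1 dnormZ.
- by rewrite sqrtr_gt0.
- move=> p q; rewrite d_dnorm koranyi_quotient.
  exact: (dnorm_gauge alpha C).
Qed.

End Rigidity.

Theorem mainTheorem1 (R : realType) (K : division_algebra) (n : nat)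
    (hn : (2 <= n)%N) (hO : K = Octonions -> n = 2%N)
    (d : heis R K n -> heis R K n -> R)
    (d_metric : is_metric d)
    (d_top : same_topology d (@koranyi R K n))
    (d_moebius : moebius d = moebius (@koranyi R K n)) :
  exists alpha beta : R,
    [/\ 0 < alpha, alpha <= 1, 0 < beta &
        forall p q : option (heis R K n),
          ext_dist d p q =
            (beta%:E * ext_dist (@koranyi R K n) p q `^ alpha)%E].
Proof.
have [alpha [beta [alpha0 alpha1 beta0 dE]]] :=
  metric_eq_koranyi_powR hn hO d d_metric d_top d_moebius.
exists alpha, beta; split=> // -[p|] [q|]; rewrite /ext_dist.
- by rewrite dE poweR_EFin EFinM.
- by rewrite poweRyr ?gt_eqF // gt0_muley ?lte_fin.
- by rewrite poweRyr ?gt_eqF // gt0_muley ?lte_fin.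
- by rewrite poweR_EFin powR0 ?gt_eqF // mule0.
Qed.
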